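(* Let $\mathcal{L}$ be a supersolvable geometric lattice. Then the combinatorial Chow ring $\mathrm{FY}(\mathcal{L},\mathcal{G}_{\max})$ admits a quadratic Gröbner basis.
   Context: A geometric lattice is a finite lattice $\mathcal{L}$ (least element $\hat 0$, greatest element $\hat 1$, join $\vee$, meet $\wedge$) in which all maximal chains between two comparable elements have the same cardinality, whose rank function $\rho$ satisfies $\rho(X\wedge Y)+\rho(X\vee Y)\le\rho(X)+\rho(Y)$, and in which every element is a join of atoms (elements of rank 1). A lattice $\mathcal{L}$ is supersolvable if it admits a maximal chain $\Delta$ such that for every chain $K$ in $\mathcal{L}$ the sublattice generated by $\Delta$ and $K$ is distributive. $\mathcal{G}_{\max}=\mathcal{L}\setminus\{\hat 0\}$ is the maximal building set of $\mathcal{L}$. The ring $\mathrm{FY}(\mathcal{L},\mathcal{G}_{\max})$ is the graded commutative ring $\mathbb{Z}[h_G,\ G\in\mathcal{L}\setminus\{\hat 0\}]/\mathcal{I}_{\mathrm{wond}}$, where $\mathcal{I}_{\mathrm{wond}}$ is generated by $h_H$ for every atom $H$ and by $\prod_{G'\in\mathcal{A}}(h_G-h_{G'})$ for every $G\in\mathcal{L}\setminus\{\hat 0\}$ and every antichain $\mathcal{A}$ in $\mathcal{L}\setminus\{\hat 0\}$ with $\bigvee\mathcal{A}=G$. Each $h_G$ has weight 1 (cohomological degree 2). An algebra admits a quadratic Gröbner basis if it can be presented as the quotient of a polynomial ring on generators of weight 1 by a homogeneous ideal which, for some monomial order, has a Gröbner basis consisting of homogeneous elements of weight 2; over $\mathbb{Z}$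 a Gröbner basis is understood with leading coefficients $\pm1$. (Here, the generators $h_H$ with $H$ an atom, which are zero, are discarded.) *)

(* Defs.v *)
From HB Require Import structures.
From mathcomp Require Import all_boot all_order all_algebra.
From mathcomp Require Import boolp.
From mathcomp Require Import mpoly.

Set Implicit Arguments.
Unset Strict Implicit.
Unset Printing Implicit Defensive.

Import Order.TTheory GRing.Theory Num.Theory.

Local Open Scope ring_scope.

Section Lattices.
Context {d : Order.disp_t}.
Implicit Type L : finTBLatticeType d.

Definition is_chain L (C : {set L}) : bool :=
  [forall x in C, forall y in C, (x >=< y)%O].

Definition chain_between L (x y : L) (C : {set L}) : bool :=
  is_chain C && [forall z in C, (x <= z <= y)%O].

Definition maximal_chain_between L (x y : L) (C : {set L}) : bool :=
  maxset (chain_between x y) C.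

Definition jordan_dedekind L : Prop :=
  forall (x y : L) (C D : {set L}), (x <= y)%O ->
    maximal_chain_between x y C -> maximal_chain_between x y D -> #|C| = #|D|.

(* Under [jordan_dedekind] all the cardinals in this maximum are equal. *)
Definition rank L (x : L) : nat :=
  \max_(C : {set L} | maximal_chain_between \bot%O x C) #|C|.-1.

Definition atom L (x : L) : bool := rank x == 1%N.

Definition geometric L : Prop :=
  [/\ jordan_dedekind L,
      forall x y : L,
        (rank (Order.meet x y) + rank (Order.join x y) <= rank x + rank y)%N
    & forall x : L, exists2 A : {set L},
        {in A, forall a, atom a} & x = (\join_(a in A) a)%O].

Definition sublattice L (S : {set L}) : bool :=
  [forall x in S, forall y in S,
     (Order.meet x y \in S) && (Order.join x y \in S)].

Definition generated_sublattice L (S : {set L}) : {set L} :=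
  \bigcap_(T : {set L} | sublattice T && (S \subset T)) T.

Definition distributive_in L (S : {set L}) : Prop :=
  {in S & &, forall x y z : L,
     Order.meet x (Order.join y z)
     = Order.join (Order.meet x y) (Order.meet x z)}.

Definition supersolvable L : Prop :=
  exists2 Delta : {set L}, maxset (@is_chain L) Delta &
    forall K : {set L}, is_chain K ->
      distributive_in (generated_sublattice (Delta :|: K)).

End Lattices.

Section Ideals.
Variable R : comNzRingType.

Definition generated_ideal (S : R -> Prop) (p : R) : Prop :=
  exists (k : nat) (c g : 'I_k -> R),
    (forall i, S (g i)) /\ p = \sum_(i < k) c i * g i.

Lemma generated_ideal0 S : generated_ideal S 0.
Proof.
exists 0%N, (fun=> 0), (fun=> 0).
by split=> [[]//|]; rewrite big_ord0.
Qed.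

Lemma generated_idealD S p q :
  generated_ideal S p -> generated_ideal S q -> generated_ideal S (p + q).
Proof.
move=> [k [c [g [Sg ->]]]] [l [c' [g' [Sg' ->]]]].
exists (k + l)%N,
  (fun i => match split i with inl a => c a | inr b => c' b end),
  (fun i => match split i with inl a => g a | inr b => g' b end).
split=> [i|]; first by case: (split i).
rewrite big_split_ord /=; congr (_ + _); apply: eq_bigr => i _.
  by rewrite (unsplitK (inl i)).
by rewrite (unsplitK (inr i)).
Qed.

Lemma generated_idealM S a p : generated_ideal S p -> generated_ideal S (a * p).
Proof.
move=> [k [c [g [Sg ->]]]]; exists k, (fun i => a * c i), g; split=> //.
by rewrite mulr_sumr; apply: eq_bigr => i _; rewrite mulrA.
Qed.

End Ideals.

Section FeichtnerYuzvinsky.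
Context {d : Order.disp_t} (L : finTBLatticeType d).

Definition Gmax : finType := {x : L | x != \bot%O}.

Definition antichain (A : {set Gmax}) : bool :=
  [forall x in A, forall y in A, (val x <= val y)%O ==> (x == y)].

Definition wond_polyring : comNzRingType := {mpoly int[#|Gmax|]}.

Definition hvar (G : Gmax) : wond_polyring := 'X_(enum_rank G).

Inductive wond_relation : wond_polyring -> Prop :=
| WondAtom (H : Gmax) : atom (val H) -> wond_relation (hvar H)
| WondAntichain (G : Gmax) (A : {set Gmax}) :
    antichain A -> (\join_(X in A) val X)%O = val G ->
    wond_relation (\prod_(X in A) (hvar G - hvar X)).

(* Membership in the ideal is made boolean classically, as required by
   [{ideal_quot _}]. *)
Definition wond_ideal : {pred wond_polyring} :=
  fun p => `[< generated_ideal wond_relation p >].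

(* The next lemmas show that the ideal is proper: every relation vanishes at
   the origin. *)
Lemma wond_relation_eval0 p : wond_relation p -> meval (fun=> 0) p = 0.
Proof.
case=> [H _|G A _ defG]; first by rewrite mevalXU.
have [X XA] : exists X, X \in A.
  apply/set0Pn/eqP => A0; move: (valP G).
  by rewrite -defG A0 big_set0 eqxx.
by rewrite rmorph_prod (bigD1 X) //= rmorphB /= !mevalXU subr0 mul0r.
Qed.

Lemma wond_ideal_closed : idealr_closed wond_ideal.
Proof.
split.
- exact/asboolP/generated_ideal0.
- apply/asboolP => -[k [c [g [Sg]]]] /(congr1 (meval (fun=> 0))).
  rewrite rmorph1 rmorph_sum big1 => [/eqP|i _]; first by rewrite oner_eq0.
  by rewrite rmorphM /= (wond_relation_eval0 (Sg i)) mulr0.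
- move=> a p q /asboolP Ip /asboolP Iq; apply/asboolP.
  exact/generated_idealD/Iq/generated_idealM.
Qed.

HB.instance Definition _ := isIdealr.Build _ wond_ideal wond_ideal_closed.

Definition FYmax : comNzRingType := {ideal_quot wond_ideal}.

Definition FYh (G : Gmax) : FYmax := \pi_({ideal_quot wond_ideal})%qT (hvar G).

(* [FYh H] is zero when [H] is an atom, so only the other elements index
   generators. *)
Definition nonatoms : finType := {G : Gmax | ~~ atom (val G)}.

Definition FYgen (i : 'I_#|nonatoms|) : FYmax := FYh (val (enum_val i)).

End FeichtnerYuzvinsky.

Section Groebner.
Variable n : nat.
Implicit Types (m : 'X_{1..n}) (p : {mpoly int[n]}) (J : {mpoly int[n]} -> Prop).

Definition monomial_order (le : rel 'X_{1..n}) : Prop :=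
  [/\ reflexive le, antisymmetric le, transitive le & total le] /\
  (forall m, le 0%MM m) /\
  (forall m1 m2 m, le m1 m2 -> le (m1 + m)%MM (m2 + m)%MM).

Definition leading_monomial (le : rel 'X_{1..n}) p m : Prop :=
  m \in msupp p /\ {in msupp p, forall m', le m' m}.

(* Leading terms of the nonzero elements of [J], coefficients included. *)
Definition leading_term_of (le : rel 'X_{1..n}) J (t : {mpoly int[n]}) : Prop :=
  exists p m, [/\ J p, leading_monomial le p m & t = p@_m *: 'X_[m]].

Definition groebner_basis (le : rel 'X_{1..n}) J (B : seq {mpoly int[n]}) : Prop :=
  [/\ {in B, forall b, J b},
      {in B, forall b, exists2 m, leading_monomial le b m
                                & (b@_m == 1) || (b@_m == -1)}
    & forall t, generated_ideal (leading_term_of le J) t <->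
                generated_ideal (leading_term_of le (fun b => b \in B)) t].

Definition homogeneous_ideal J : Prop :=
  forall p k, J p -> J (pihomog mdeg k p).

End Groebner.

(* The ring [A] is presented as a quotient of a polynomial ring over the
   integers whose i-th variable, of weight 1, is sent to [g i]. *)
Definition admits_quadratic_groebner_basis
    (A : comNzRingType) (n : nat) (g : 'I_n -> A) : Prop :=
  let eval : {mpoly int[n]} -> A := mmap intr g in
  let ker := fun p => eval p = 0 in
  [/\ forall a : A, exists p, eval p = a,
      homogeneous_ideal ker
    & exists2 le : rel 'X_{1..n}, monomial_order le &
      exists2 B : seq {mpoly int[n]},
        groebner_basis le ker B & {in B, forall b, b \is 2.-homog}].

(* Main.v *)
Require Import Defs.
From HB Require Import structures.
From mathcomp Require Import all_boot all_order all_algebra.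
From mathcomp Require Import zify ring boolp.
From mathcomp Require Import ssrcomplements mpoly.

Set Implicit Arguments.
Unset Strict Implicit.
Unset Printing Implicit Defensive.

Import Order.TTheory GRing.Theory.

(** Let [D 0 <= D 1 <= ...] be the maximal chain given by supersolvability. Its
   elements are modular. A flat [x] therefore has as many labels as its rank,
   the label [i] meaning that [x `&` D i] grows from [i] to [i.+1]. The meets
   [x `&` D i] are the initial segments of [x]; the largest proper one,
   [trunc x], is covered by [x]. The generators are ordered by [prec],
   a dictionary order on label sequences: proper initial segments of [x] come
   before [x], all other elements below [x] come after [x]
   ([initial_prec], [noninitial_prec]).

   Leading terms. Write [h_x] for the class of [x]. If [x] and [y] are
   incomparable with join [z], then [(h_z - h_x) * (h_z - h_y) = 0]. If [z]
   covers [x] then [z] is the join of [x] and an atom, so that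
   [(h_z - h_x) * h_z = 0]. Combinations of these relations express every
   square, and every product [h_A * h_B] such that [A] comes before [B] and
   [compatible A B] fails, in terms of products of smaller pairs
   ([nonstandard_rewrites]). These rewriting rules are the basis. It remains
   to see that a standard monomial, one that no such product divides, is never
   the leading monomial of an element of the kernel.

   Independence. Each standard monomial [S] gets a linear functional which
   vanishes on the ideal, equals 1 at [S], and vanishes at all smaller
   monomials. In top degree the natural functional is the degree map of the
   Chow ring, which sends a monomial to 1 if any nonempty submultiset [I] of
   its factors has a join of rank larger than the size of [I], and to 0
   otherwise: the dragon Hall-Rado condition. The same condition is used here
   in the intervals of a chain of flats ([fits], [admissible]). It defines the
   independent sets of a matroid, and the relation attached to an antichain
   [A] with join [g] is killed because some [x] in [A] lies in no circuit
   ([coloop_exists]): exchanging [x] and [g] cancels the terms of the relation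
   in pairs ([functional_prod0], [functional_ideal]).

   Choice of the chain. Join the factors of [S] one by one, from the last to
   the first. At each stage the factors that are below the new join [U], but
   not below the previous one, are initial segments of [U]
   ([compatible_join], [group_run]). One can choose a flat [X] between the two
   joins such that these segments are the smallest possible independent family
   in the interval from [X] to [U] ([run_base], [group_prec]). So a monomial of
   the degree of [S] on which the functional does not vanish has, for every
   [v], at most as many factors before [v] as [S] has ([standard_flag]). The
   monomial order [tail_le] compares lexicographically the numbers of factors
   that are not before [v], so such a monomial is not smaller than [S]. *)

(** * Ranks in a geometric lattice *)

Ltac nat_lia :=
  repeat match goal with
  | H : ?T |- _ =>
    lazymatch type of T with
    | Prop => lazymatch T with
              | is_true (leq _ _) => fail
              | @eq ?A _ _ => tryif unify A nat then fail else clear H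
              | _ => clear H
              end
    end
  end; lia.

Section Geometric.
Context {d : Order.disp_t} {L : finTBLatticeType d}.
Implicit Types (x y z a : L) (C : {set L}).
Local Open Scope order_scope.

Lemma is_chainP C : reflect {in C &, forall x y, x >=< y} (is_chain C).
Proof.
apply: (iffP 'forall_in_forall_inP) => H x y; first by move=> xC yC; exact: H.
by move=> xC yC; exact: H.
Qed.

Lemma chain_add C y :
  is_chain C -> {in C, forall x, x >=< y} -> is_chain (y |: C).
Proof.
move=> /is_chainP chC Cy; apply/is_chainP => u v.
rewrite !inE => /orP[/eqP->|uC] /orP[/eqP->|vC]; rewrite ?comparablexx ?Cy //.
  by rewrite comparable_sym; exact: Cy.
exact: chC.
Qed.

Lemma maximal_chain_exists x y C : chain_between x y C ->
  exists2 C' : {set L}, maximal_chain_between x y C' & C \subset C'.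
Proof. by move=> /maxset_exists[C' ? ?]; exists C'. Qed.

Lemma chain_between_bot x C : chain_between \bot x C -> chain_between \bot x (\bot |: C).
Proof.
move=> /andP[chC /'forall_implyP inC]; apply/andP; split.
  by apply: chain_add => // u _; rewrite comparable_sym le_comparable ?le0x.
apply/'forall_implyP => u; rewrite !inE => /predU1P[->|/inC//].
by rewrite lexx le0x.
Qed.

Lemma card_maximal_chain_gt0 x C : maximal_chain_between \bot x C -> (0 < #|C|)%N.
Proof.
move=> /maxsetP[chC maxC]; rewrite card_gt0; apply/set0Pn; exists \bot.
by rewrite -(maxC _ (chain_between_bot chC)) ?subsetUr // setU11.
Qed.

Lemma chain_between0 x y : chain_between x y set0.
Proof.
apply/andP; split; first by apply/is_chainP => u v; rewrite inE.
by apply/'forall_implyP => u; rewrite inE.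
Qed.

Lemma rank_lt x y : x < y -> (rank x < rank y)%N.
Proof.
move=> ltxy.
have key C : maximal_chain_between \bot x C -> (#|C| <= rank y)%N.
  move=> /maxsetP[chC maxC]; have /andP[chC1 /'forall_implyP inC] := chC.
  have [|C' mC' sC'] := @maximal_chain_exists \bot y (y |: C).
    apply/andP; split.
      apply: chain_add => // u /inC /andP[_ leux].
      by rewrite le_comparable // (le_trans leux (ltW ltxy)).
    apply/'forall_implyP => u; rewrite !inE => /predU1P[->|/inC /andP[-> leux]].
      by rewrite le0x lexx.
    by rewrite (le_trans leux (ltW ltxy)).
  have yC : y \notin C.
    by apply/negP => /inC /andP[_]; rewrite (lt_geF ltxy).
  apply: leq_trans (leq_bigmax_cond _ mC').
  by have := subset_leq_card sC'; rewrite cardsU1 yC; lia.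
have [C0 mC0 _] := maximal_chain_exists (chain_between0 \bot x).
have C0y := key _ mC0; have C0gt := card_maximal_chain_gt0 mC0.
suff : (rank x <= (rank y).-1)%N by lia.
apply/bigmax_leqP => C mC; have := key _ mC; lia.
Qed.

Lemma rank_le x y : x <= y -> (rank x <= rank y)%N.
Proof. by rewrite le_eqVlt => /predU1P[->//|/rank_lt/ltnW]. Qed.

Lemma rank_eq x y : x <= y -> (rank y <= rank x)%N -> x = y.
Proof. by rewrite le_eqVlt => /predU1P[->//|/rank_lt]; rewrite ltnNge => /negP. Qed.

Lemma rank0 : rank (\bot : L) = 0%N.
Proof.
apply/eqP; rewrite -leqn0; apply/bigmax_leqP => C /maxsetP[/andP[_ /'forall_implyP inC] _].
suff /subset_leq_card : C \subset [set \bot] by rewrite cards1; lia.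
by apply/subsetP => u /inC; rewrite inE lex0 => /andP[].
Qed.

Hypothesis geoL : geometric L.

Lemma rank_modular x y :
  (rank (x `&` y) + rank (x `|` y) <= rank x + rank y)%N.
Proof. by case: geoL. Qed.

Lemma atom_between x y :
  ~~ (y <= x) -> exists a : L, [/\ atom a, a <= y & ~~ (a <= x)].
Proof.
move=> nyx; have [_ _ /(_ y)[A atA defy]] := geoL.
have [a aA nax] : exists2 a, a \in A & ~~ (a <= x).
  apply/exists_inP; apply: contraR nyx; rewrite negb_exists_in => /forall_inP Ax.
  by rewrite defy; apply/joinsP => a /Ax; rewrite negbK.
by exists a; split=> //; [exact: atA | rewrite defy; exact: joins_sup].
Qed.

Lemma rank_join_atom x a : atom a -> ~~ (a <= x) -> rank (x `|` a) = (rank x).+1.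
Proof.
move=> /eqP ra nax; have := rank_modular x a; have: (rank x < rank (x `|` a))%N.
  by apply: rank_lt; rewrite lt_neqAle leUl andbT eq_sym eq_joinl.
lia.
Qed.

(** This is how the vanishing of the class of an atom will bear on covers. *)
Lemma coatom_join x y : x < y -> (rank y <= (rank x).+1)%N ->
  exists2 a : L, atom a & a <= y /\ x `|` a = y.
Proof.
move=> ltxy ryx; have [|a [ata leay nax]] := @atom_between x y.
  by rewrite (lt_geF ltxy).
exists a => //; split=> //; apply: rank_eq; first by rewrite leUx (ltW ltxy).
by rewrite rank_join_atom.
Qed.

End Geometric.

(** * Lexicographic comparison *)

Lemma lexi_lt_nth (s t : seq nat) k :
    (forall i, (i < k)%N -> (nth 0 s i <= nth 0 t i)%N) ->
    (k < size s)%N -> (k < size t)%N -> (nth 0 s k < nth 0 t k)%N ->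
  ((s : seqlexi nat) < (t : seqlexi nat))%O.
Proof.
elim: k s t => [|k IH] [|x s] [|y t] //= Hle ks kt Hlt; rewrite ltxi_cons !leEnat.
  by rewrite (ltnW Hlt) /= [(y <= x)%N]leqNgt Hlt.
rewrite (Hle 0%N) //=; apply/implyP => _; apply: IH => // i ik.
exact: (Hle i.+1).
Qed.

Lemma lexi_le_nth (s t : seq nat) : size s = size t ->
    (forall i, (nth 0 s i <= nth 0 t i)%N) ->
  ((s : seqlexi nat) <= (t : seqlexi nat))%O.
Proof.
elim: s t => [|x s IH] [|y t] //= [st] Hle; rewrite lexi_cons leEnat (Hle 0%N) /=.
by apply/implyP => _; apply: IH => // i; exact: (Hle i.+1).
Qed.

(** * Modular flags, labels and the order of the generators *)

Section ModularFlag.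
Context {d : Order.disp_t} {L : finTBLatticeType d}.
Local Open Scope order_scope.

(** The left modular maximal chain of a supersolvable lattice. The indexing by
   rank is continued by the greatest element, which makes [D] total. *)
Definition modular_flag (D : nat -> L) : Prop :=
  [/\ D 0%N = \bot, forall i, D i <= D i.+1, D (rank (\top : L)) = \top,
      forall i, (rank (D i.+1) <= (rank (D i)).+1)%N
    & forall i x y, x <= y -> y `&` (x `|` D i) = x `|` (y `&` D i)].

Hypothesis geoL : geometric L.

(** If the next element of the chain were not a cover, the join of [x] and an
   atom could be inserted between the two. *)
Lemma maximal_chain_cover (Delta : {set L}) x :
    maxset (@is_chain d L) Delta -> x \in Delta -> x != \top ->
  exists2 y, y \in Delta & (x <= y) && (rank y == (rank x).+1).
Proof.
move=> /maxsetP[chD maxD] xD xtop.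
have memD z : {in Delta, forall u, u >=< z} -> z \in Delta.
  move=> Dz; rewrite -(maxD (z |: Delta)) ?subsetUr ?setU11 //.
  exact: chain_add.
have topD : \top \in Delta by apply: memD => u _; rewrite le_comparable ?lex1.
have above_top : (\top \in Delta) && (x < \top) by rewrite topD lt_neqAle xtop lex1.
case: (@arg_minnP _ \top (fun y : L => (y \in Delta) && (x < y)) (@rank d L) above_top).
move=> y /andP[yD ltxy] ymin; exists y; rewrite ?ltW //=.
rewrite eqn_leq rank_lt // andbT leqNgt; apply/negP => ry.
have [|a [ata leay nax]] := @atom_between _ _ geoL x y; first by rewrite (lt_geF ltxy).
have rz := rank_join_atom geoL ata nax; set z := x `|` a in rz.
have lexz : x <= z by exact: leUl.
have lezy : z <= y by rewrite leUx (ltW ltxy).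
suff /ymin : (z \in Delta) && (x < z) by rewrite rz leqNgt ry.
rewrite andbC lt_neqAle lexz andbT; apply/andP; split.
  by apply/eqP => xz; move: rz; rewrite -xz; lia.
apply: memD => u uD.
have /orP[leux|lexu] : u >=< x by move/is_chainP: chD; apply.
  by rewrite le_comparable // (le_trans leux).
have [<-|nxu] := eqVneq x u; first by rewrite le_comparable.
have /orP[leyu|leuy] : y >=< u by move/is_chainP: chD; apply.
  by rewrite comparable_sym le_comparable // (le_trans lezy).
have [->|nuy] := eqVneq u y; first by rewrite comparable_sym le_comparable.
have: (rank y <= rank u)%N by apply: ymin; rewrite uD lt_neqAle nxu lexu.
by rewrite leqNgt rank_lt // lt_neqAle nuy.
Qed.

(** Distributivity of the sublattice generated by the chain and by [x <= y]
   contains the modular law for [x] and [y]. *)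
Lemma supersolvable_modular_flag :
  supersolvable L -> exists D : nat -> L, modular_flag D.
Proof.
move=> [Delta maxD distD]; have /maxsetP[chD maxD'] := maxD.
set n := rank (\top : L).
have botD : \bot \in Delta.
  rewrite -(maxD' (\bot |: Delta)) ?subsetUr ?setU11 //.
  by apply: chain_add => // u _; rewrite comparable_sym le_comparable ?le0x.
have rank_ex i : exists y, (y \in Delta) && (rank y == minn i n).
  elim: i => [|i [y /andP[yD /eqP ry]]]; first by exists \bot; rewrite botD rank0 min0n.
  have [ytop|ntop] := eqVneq y \top.
    exists y; rewrite yD; move: ry; rewrite ytop -/n => ry; apply/eqP; lia.
  have [z zD /andP[lez /eqP rz]] := maximal_chain_cover maxD yD ntop.
  exists z; rewrite zD rz ry; have: (rank y < n)%N by rewrite rank_lt // lt_neqAle ntop lex1.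
  rewrite ry => ltn; apply/eqP; lia.
pose D i := xchoose (rank_ex i).
have DD i : D i \in Delta by have /andP[] := xchooseP (rank_ex i).
have rD i : rank (D i) = minn i n by have /andP[_ /eqP] := xchooseP (rank_ex i).
exists D; split.
- by apply/esym/rank_eq; rewrite ?le0x // rD min0n.
- move=> i; have /orP[//|le] : D i >=< D i.+1 by move/is_chainP: chD; apply.
  by rewrite (@rank_eq _ _ _ _ le) // !rD; lia.
- by apply: rank_eq; rewrite ?lex1 // rD minnn.
- by move=> i; rewrite !rD; lia.
- move=> i x y lexy; have chK : is_chain [set x; y].
    apply/is_chainP => u v; rewrite !inE.
    by move=> /orP[]/eqP-> /orP[]/eqP->; rewrite ?comparablexx // ?(le_comparable lexy) // comparable_sym le_comparable.
  have gen u : u \in Delta :|: [set x; y] -> u \in generated_sublattice (Delta :|: [set x; y]).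
    by move=> uS; apply/bigcapP => T /andP[_ /subsetP]; apply.
  rewrite (distD _ chK) ?gen ?inE ?eqxx ?DD ?orbT //.
  by rewrite (meet_r lexy).
Qed.

Section Theory.
Variable D : nat -> L.
Hypothesis flagD : modular_flag D.
Local Notation n := (rank (\top : L)).

Lemma flag_bot : D 0%N = \bot. Proof. by case: flagD. Qed.

Lemma flag_le i j : (i <= j)%N -> D i <= D j.
Proof.
have [_ Dle _ _ _] := flagD.
exact: (@homo_leq _ D (fun x y => x <= y) (@lexx _ _) (@le_trans _ _)).
Qed.

Lemma flag_meet x i j : (i <= j)%N -> x `&` D j `&` D i = x `&` D i.
Proof. by move=> ij; rewrite -meetA (meet_r (flag_le ij)). Qed.

Lemma flag_top i : (n <= i)%N -> D i = \top.
Proof.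
move=> ni; have [_ _ Dn _ _] := flagD.
by apply: le_anti; rewrite lex1 -{1}Dn flag_le.
Qed.

Lemma flag_modl i x y : x <= y -> y `&` (x `|` D i) = x `|` (y `&` D i).
Proof. by case: flagD => _ _ _ _; apply. Qed.

(** The modular law makes [z |-> D i `|` z] strictly increasing above
   [D i `&` y], which forces equality in the semimodular inequality. *)
Lemma flag_rank i y :
  (rank (D i) + rank y <= rank (D i `|` y) + rank (D i `&` y))%N.
Proof.
have key k z : D i `&` y <= z -> z <= y -> (rank y - rank z <= k)%N ->
    (rank y + rank (D i `|` z) <= rank (D i `|` y) + rank z)%N.
  elim: k z => [|k IH] z lez lezy rk.
    have -> : z = y by apply: rank_eq => //; lia.
    by rewrite addnC.
  have [->|nzy] := eqVneq z y; first by rewrite addnC.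
  have [|a [ata leay naz]] := @atom_between _ _ geoL z y.
    by rewrite lt_geF // lt_neqAle nzy.
  have rz1 := rank_join_atom geoL ata naz; set z1 := z `|` a in rz1.
  have lezz1 : z <= z1 by exact: leUl.
  have lez1y : z1 <= y by rewrite leUx lezy.
  have ltD : (rank (D i `|` z) < rank (D i `|` z1))%N.
    apply: rank_lt; rewrite lt_neqAle leU2 // andbT; apply/eqP => eqD.
    suff : z1 <= z by move=> /rank_le; rewrite rz1 ltnn.
    have <- : z1 `&` (z `|` D i) = z1 by apply/meet_l; rewrite joinC eqD leUr.
    rewrite (flag_modl _ lezz1) leUx lexx /= (le_trans _ lez) //.
    by rewrite meetC leI2.
  have := IH z1 (le_trans lez lezz1) lez1y; lia.
have := key _ (D i `&` y) (lexx _) (leIr _ _) (leqnn _).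
by rewrite meetKU addnC.
Qed.

(** Both sides have the same rank by [flag_rank]: left modular elements of a
   geometric lattice are also modular in the dual sense. *)
Lemma flag_modr i x y : x <= D i -> D i `&` (x `|` y) = x `|` (D i `&` y).
Proof.
move=> leD; apply/esym/rank_eq.
  by rewrite leUx lexI leD leUl leI2 // leUr.
set u := x `|` (D i `&` y).
have uy : u `&` y = D i `&` y.
  apply: le_anti; apply/andP; split; last by rewrite lexI leUr leIr.
  by rewrite leI2 // leUx leD leIl.
have uUy : u `|` y = x `|` y.
  by rewrite /u -joinA; congr (_ `|` _); apply/join_r/leIr.
have DUy : D i `|` (x `|` y) = D i `|` y by rewrite joinA (join_l leD).
have := rank_modular geoL u y; rewrite uy uUy.
have := rank_modular geoL (D i) (x `|` y); rewrite DUy.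
have := flag_rank i y; lia.
Qed.

Lemma rank_meetS x i : (rank (x `&` D i.+1) <= (rank (x `&` D i)).+1)%N.
Proof.
have [_ _ _ rS _] := flagD; have Dle := flag_le (leqnSn i).
have := flag_rank i (x `&` D i.+1); have := rS i.
have -> : D i `&` (x `&` D i.+1) = x `&` D i.
  by rewrite meetCA (meet_l Dle).
have : (rank (D i `|` (x `&` D i.+1)) <= rank (D i.+1))%N.
  by apply: rank_le; rewrite leUx Dle leIr.
lia.
Qed.

(** Labels are numbered from 0: [label x i] belongs to the step from [D i] to
   [D i.+1]. *)
Definition label x i : bool := x `&` D i.+1 != x `&` D i.

Lemma rank_label x j : rank (x `&` D j) = count (label x) (iota 0 j).
Proof.
elim: j => [|j IH]; first by rewrite flag_bot meetx0 rank0.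
rewrite -addn1 iotaD count_cat /= -IH addn1 add0n addn0 /label.
have le : x `&` D j <= x `&` D j.+1 by rewrite leI2 // flag_le.
have := rank_meetS x j; case: eqVneq => [->|neq]; first by rewrite addn0.
have : (rank (x `&` D j) < rank (x `&` D j.+1))%N by rewrite rank_lt // lt_neqAle eq_sym neq.
by move=> ? ? /=; lia.
Qed.

Lemma rank_labels x : rank x = count (label x) (iota 0 n).
Proof. by rewrite -rank_label flag_top ?meetx1. Qed.

Lemma label_le x y i : x <= y -> label x i -> label y i.
Proof.
move=> lexy; apply: contraNN => /eqP eqy.
by rewrite -(meet_l lexy) -!meetA eqy.
Qed.

Lemma label_lt x i : label x i -> (i < n)%N.
Proof.
by apply: contraTT; rewrite -leqNgt => ni; rewrite /label !flag_top ?eqxx //; lia.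
Qed.

Definition level x := find (fun i => x <= D i) (iota 0 n).

Lemma level_leP x i : (level x <= i)%N = (x <= D i).
Proof.
have lex : x <= D (level x).
  case: (boolP (has (fun i => x <= D i) (iota 0 n))) => [hs|/hasNfind].
    have := nth_find 0 hs; rewrite nth_iota ?add0n //.
    by rewrite -[X in (_ < X)%N](size_iota 0) -has_find.
  by rewrite size_iota /level => ->; rewrite flag_top ?lex1.
apply/idP/idP => [li|]; first by rewrite (le_trans lex) ?flag_le.
apply: contraTT; rewrite -ltnNge => li.
have := @before_find _ 0 (fun i => x <= D i) (iota 0 n) _ li.
rewrite nth_iota ?add0n => [->//|]; rewrite (leq_trans li) //.
by rewrite -[X in (_ <= X)%N](size_iota 0) find_size.
Qed.

Lemma level_le x y : x <= y -> (level x <= level y)%N.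
Proof. by move=> le; rewrite level_leP (le_trans le) // -level_leP. Qed.

Lemma le_level x : x <= D (level x). Proof. by rewrite -level_leP. Qed.

Lemma level_gt0 x : x != \bot -> (0 < level x)%N.
Proof. by rewrite -lex0 -flag_bot -level_leP; lia. Qed.

Lemma level_max x : (level x <= n)%N.
Proof. by rewrite level_leP flag_top ?lex1. Qed.

(** The largest proper initial segment of [x]. *)
Definition trunc x := x `&` D (level x).-1.

Lemma trunc_le x : trunc x <= x. Proof. exact: leIl. Qed.

Lemma trunc_lt x : x != \bot -> trunc x < x.
Proof.
move=> nx; rewrite lt_neqAle trunc_le andbT eq_meetl -level_leP.
by have := level_gt0 nx; lia.
Qed.

Lemma trunc_rank x : (rank x <= (rank (trunc x)).+1)%N.
Proof.
have [->|nx] := eqVneq x \bot; first by rewrite rank0.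
have := rank_meetS x (level x).-1; rewrite prednK ?level_gt0 //.
by rewrite (meet_l (le_level x)).
Qed.

Definition initial x y := x == y `&` D (level x).

Lemma initialP x y i : x = y `&` D i -> initial x y.
Proof.
move=> def; have li : (level x <= i)%N by rewrite level_leP def leIr.
apply/eqP/le_anti; rewrite lexI le_level andbT {1}def leIl /=.
by rewrite {2}def leI2 // flag_le.
Qed.

Lemma initial_le x y : initial x y -> x <= y.
Proof. by move/eqP->; rewrite leIl. Qed.

Lemma initial_meet x y z : initial x z -> x <= y -> y <= z -> initial x y.
Proof.
move=> /eqP def lexy leyz; apply/eqP/le_anti; rewrite lexI lexy le_level /=.
by rewrite {2}def leI2.
Qed.

Lemma initial_trans x y z : initial x y -> initial y z -> initial x z.
Proof.
move=> ixy /eqP def; have lev := level_le (initial_le ixy).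
apply/eqP; rewrite {1}(eqP ixy) {1}def -meetA; congr (_ `&` _).
by rewrite meetC; apply/meet_l/flag_le.
Qed.

Lemma initial_trunc x : initial (trunc x) x.
Proof. exact: initialP. Qed.

Lemma initial_level x y z : initial x z -> initial y z ->
  (level x <= level y)%N -> initial x y.
Proof.
move=> ix iy lev; apply: (initial_meet ix); last exact: initial_le.
by rewrite (eqP ix) (eqP iy) leI2 // flag_le.
Qed.

Lemma initial_lt_trunc x y z : initial x z -> initial y z -> x < y -> x <= trunc y.
Proof.
move=> ix iy ltxy; rewrite lexI ltW //= -level_leP.
suff : (level x < level y)%N by lia.
rewrite ltnNge; apply/negP => /(initial_level iy ix) /initial_le.
by rewrite (lt_geF ltxy).
Qed.

(** The sequence of weights turns the dictionary order on label sequences into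
   a lexicographic order on sequences of equal length: an exhausted label
   sequence must come first, and a present label must come before a skipped
   one, since skipping makes the next label larger. *)
Definition weight x i : nat :=
  if (i < level x)%N then (if label x i then 1 else 2) else 0.

(** The last entry breaks ties and makes [prec] total. *)
Definition code x : seq nat := rcons (mkseq (weight x) n) (enum_rank x).

Lemma size_code x : size (code x) = n.+1.
Proof. by rewrite size_rcons size_mkseq. Qed.

Lemma nth_code x i : (i < n)%N -> nth 0 (code x) i = weight x i.
Proof. by move=> lin; rewrite nth_rcons size_mkseq lin nth_mkseq. Qed.

Lemma code_inj : injective code.
Proof.
move=> x y /(congr1 (last 0)); rewrite !last_rcons => /ord_inj.
exact: enum_rank_inj.
Qed.

Definition prec x y := ((code x : seqlexi nat) < (code y : seqlexi nat))%O.

Lemma prec_irr x : prec x x = false. Proof. by rewrite /prec ltxx. Qed.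

Lemma prec_trans : transitive prec.
Proof. by move=> y x z; exact: lt_trans. Qed.

Lemma prec_total x y : x != y -> prec x y || prec y x.
Proof.
move=> nxy; rewrite /prec -neq_lt; apply: contraNneq nxy => eqc.
exact/eqP/code_inj.
Qed.

Lemma prec_asym x y : prec x y -> ~~ prec y x.
Proof. by rewrite /prec => lt; rewrite (lt_gtF lt). Qed.

Lemma code_lt x y k : (k < n)%N ->
    (forall i, (i < k)%N -> (weight x i <= weight y i)%N) ->
  (weight x k < weight y k)%N -> prec x y.
Proof.
move=> kn wle wlt; apply: (@lexi_lt_nth _ _ k); rewrite ?size_code ?ltnS ?(ltnW kn) //.
  by move=> i ik; rewrite !nth_code ?(ltn_trans ik kn) // wle.
by rewrite !nth_code.
Qed.

Lemma initial_prec x y : initial x y -> x != y -> prec x y.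
Proof.
move=> ixy nxy; have lxy := level_le (initial_le ixy).
have lt : (level x < level y)%N.
  rewrite ltn_neqAle lxy andbT; apply: contraNneq nxy => eql.
  by rewrite (eqP ixy) eql (meet_l (le_level y)).
apply: (@code_lt _ _ (level x)); first by rewrite (leq_trans lt) ?level_max.
  move=> i ilt; rewrite /weight ilt (ltn_trans ilt lt).
  suff -> : label x i = label y i by [].
  by rewrite /label {1 2}(eqP ixy) !flag_meet // ltnW.
by rewrite /weight ltnn lt; case: ifP.
Qed.

(** The labels of [x] are labels of [y]; the first label of [y] that [x] skips
   below its own level makes [x] larger. *)
Lemma noninitial_prec x y : x <= y -> ~~ initial x y -> prec y x.
Proof.
move=> lexy nixy; have lxy := level_le lexy.
have wle i : (i < level x)%N -> (weight y i <= weight x i)%N.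
  move=> ilt; rewrite /weight ilt (leq_trans ilt lxy).
  by case lx: (label x i); [rewrite (label_le lexy lx) | case: ifP].
have : has (fun i => label y i && ~~ label x i) (iota 0 (level x)).
  apply: contraR nixy => /hasPn H; apply/eqP/rank_eq; first by rewrite lexI lexy le_level.
  rewrite rank_label -{2}(meet_l (le_level x)) rank_label.
  rewrite -[leqRHS](@eq_in_count _ (label y)) // => i /H.
  rewrite negb_and negbK; case lx: (label x i); first by rewrite (label_le lexy lx).
  by rewrite orbF => /negbTE.
move=> /hasP[k]; rewrite mem_iota /= add0n => kl /andP[ly nlx].
apply: (@code_lt _ _ k); first by rewrite (leq_trans kl) ?level_max.
  by move=> i ik; apply: wle; rewrite (ltn_trans ik).
by rewrite /weight kl (leq_trans kl lxy) ly (negbTE nlx).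
Qed.

(** When [x] comes before [y] these are the standard pairs: either [x] is an
   initial segment of [y], or the part of [y] at the level of [x] lies at least
   two ranks below [x]. *)
Definition compatible x y :=
  (y `&` D (level x) == x) || (y `&` D (level x) < trunc x).

(** By modularity the part of [y `|` z] at the level of [y] is the join of [y]
   and the part of [z] at that level, which is below [y]. *)
Lemma compatible_initial y z : compatible y z -> initial y (y `|` z).
Proof.
move=> cyz; apply/eqP/esym.
rewrite meetC flag_modr ?le_level // [D _ `&` z]meetC; apply/join_l.
by case/orP: cyz => [/eqP->//|/ltW le]; rewrite (le_trans le) ?trunc_le.
Qed.

(** The delicate case is that of [y] and of the part of [z] at the level of [x]
   both strictly below [trunc x]: if they had join [trunc x], then [y] would be
   an initial segment of it, hence of [x]. *)
Lemma compatible_join x y z : compatible x y -> compatible x z -> compatible y z ->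
  ~~ initial y x -> compatible x (y `|` z).
Proof.
move=> cxy cxz cyz niyx.
have ly : (y `|` z) `&` D (level y) = y by exact/esym/eqP/compatible_initial.
have [lev|lev] := leqP (level x) (level y).
  have -> : compatible x (y `|` z) = compatible x y; last exact: cxy.
  rewrite /compatible; suff -> : (y `|` z) `&` D (level x) = y `&` D (level x) by [].
  by rewrite -(flag_meet (y `|` z) lev) ly.
have leyD : y <= D (level x) by rewrite -level_leP ltnW.
have yD : y `&` D (level x) = y by exact/meet_l.
have ltyx : y < trunc x.
  by move: cxy; rewrite /compatible yD => /predU1P[eqyx|//]; move: lev; rewrite eqyx ltnn.
have defj : (y `|` z) `&` D (level x) = y `|` (z `&` D (level x)).
  by rewrite meetC flag_modr // [D _ `&` z]meetC.
rewrite /compatible defj; case/orP: cxz => [/eqP->|ltz].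
  by apply/orP; left; apply/eqP/join_r; rewrite (le_trans (ltW ltyx)) ?trunc_le.
apply/orP; right; rewrite lt_neqAle leUx (ltW ltyx) (ltW ltz) !andbT.
apply: contraNneq niyx => eqt; apply: initial_trans (initial_trunc x).
apply/eqP; rewrite -eqt -defj -meetA (meet_r (flag_le (ltnW lev))).
by rewrite ly.
Qed.

End Theory.
End ModularFlag.

(** * Prescribing the missing labels in an interval *)

Lemma count_sub_le (T : Type) (a b : pred T) (s : seq T) :
  (count a s <= count b s + count (fun x => a x && ~~ b x) s)%N.
Proof. by elim: s => //= x s IH; case: (a x); case: (b x) => /=; nat_lia. Qed.

Section RunBase.
Context {d : Order.disp_t} {L : finTBLatticeType d}.
Local Open Scope order_scope.
Hypothesis geoL : geometric L.
Variable D : nat -> L.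
Hypothesis flagD : modular_flag D.
Local Notation n := (rank (\top : L)).
Local Notation label := (label D).
Local Notation level := (level D).
Local Notation trunc := (trunc D).
Local Notation initial := (initial D).
Local Notation prec := (prec D).

(** A maximal [X] between [W] and [U] without labels in [q] works: any other
   label of [U] can be added to [X] by joining an atom. *)
Lemma avoid_labels W U (q : pred nat) : W <= U ->
    (forall i, q i -> ~~ label W i) ->
  exists X, [/\ W <= X, X <= U & forall i, label X i = label U i && ~~ q i].
Proof.
move=> leWU Wq.
pose P X := [&& W <= X, X <= U & all (fun i => q i ==> ~~ label X i) (iota 0 n)].
have PW : P W by rewrite /P lexx leWU; apply/allP => i _; apply/implyP/Wq.
case: (@arg_maxnP _ W P (@rank d L) PW) => X /and3P[leWX leXU /allP Xq] Xmax.
have qX i : q i -> ~~ label X i.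
  move=> qi; apply/negP => lX; have lin := label_lt flagD lX.
  by move: (Xq i); rewrite mem_iota add0n lin /= => /(_ isT); rewrite qi lX.
exists X; split=> // i; apply/idP/andP => [lX|[lU nq]].
  by split; [exact: label_le lX | apply/negP => /qX; rewrite lX].
apply: contraT => nlX; have lin := label_lt flagD lU.
have [|a [ata leaU naU]] := @atom_between _ _ geoL (U `&` D i) (U `&` D i.+1).
  apply: contra lU => le; apply/eqP/le_anti; rewrite le /=.
  by rewrite leI2 // (flag_le flagD).
have naD : ~~ (a <= D i) by apply: contra naU; rewrite lexI => ->; rewrite (le_trans leaU) ?leIl.
have leaD : a <= D i.+1 by rewrite (le_trans leaU) ?leIr.
have la Y : a <= Y -> label Y i.
  move=> leaY; apply/negP => /eqP eqY; case/negP: naD.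
  have : a <= Y `&` D i.+1 by rewrite lexI leaY.
  by rewrite eqY lexI => /andP[].
have naX : ~~ (a <= X) by apply: contra nlX; exact: la.
have rY := rank_join_atom geoL ata naX; set Y := X `|` a in rY.
have leXY : X <= Y by exact: leUl.
suff /Xmax : P Y by rewrite /= rY ltnn.
rewrite /P (le_trans leWX leXY) leUx leXU (le_trans leaU) ?leIl //=.
apply/allP => k; rewrite mem_iota add0n /= => kn; apply/implyP => qk; apply/negP => lY.
have nik : i != k by apply: contraNneq nq => ->.
have cY : count (label Y) (iota 0 n) = (count (label X) (iota 0 n)).+1.
  by rewrite -(rank_labels geoL flagD X) -(rank_labels geoL flagD Y).
have : ((count (label X) (iota 0 n) + (count_mem i (iota 0 n) + count_mem k (iota 0 n)))
   <= count (label Y) (iota 0 n))%N.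
  elim: (iota 0 n) => //= j s IH.
  rewrite [X in (_ + X <= _)%N]addnACA addnACA; apply: leq_add; last exact: IH.
  have [->|nji] := eqVneq j i.
    by rewrite (negbTE nik) (negbTE nlX) la // leUr.
  have [->|njk] := eqVneq j k; first by rewrite lY (negbTE (qX _ qk)).
  by rewrite addn0; case lX: (label X j); rewrite ?(label_le leXY lX).
have mem1 u : (u < n)%N -> count_mem u (iota 0 n) = 1%N.
  by move=> lt; rewrite count_uniq_mem ?iota_uniq // mem_iota lt.
by rewrite cY (mem1 _ lin) (mem1 _ kn) addnA !addn1 ltnn.
Qed.

(** The flat [X] lacks the top label of each element of [P] and one smaller label
   [e]. So the members of [P], which form a chain of initial segments of [U],
   have ranks 2, 3, ... over [X]: the last clause says that they form an
   independent family, and the clause before it bounds an independent family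
   of flats below [trunc s] by the number of elements of [P] before [s]. *)
Lemma run_base W U (P : {set L}) : W <= U ->
    (forall p, p \in P -> [/\ initial p U, p != \bot & W `&` D (level p) < trunc p]) ->
  exists X, [/\ W <= X, X <= U,
    ((rank U - rank X).-1 <= #|P|)%N,
    forall s, s \in P ->
      ((rank (X `|` trunc s) - rank X).-1 <= #|[set p in P | prec p s]|)%N
    & forall Z, X <= Z -> Z <= U ->
      (#|[set p in P | (p <= Z)%O]| <= (rank Z - rank X).-1)%N].
Proof.
move=> leWU HP; have [->|[p0' p0'P]] := set_0Vmem P.
  exists U; split=> //; first by rewrite subnn.
    by move=> s; rewrite inE.
  by move=> Z _ _; rewrite (_ : [set p in _ | _] = set0) ?cards0 //; apply/setP => p; rewrite !inE.
case: (@arg_minnP _ p0' (mem P) level p0'P) => p0 p0P p0min {p0' p0'P}.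
have [ip0 np0 Wp0] := HP _ p0P.
have truncE s : s \in P -> trunc s = U `&` D (level s).-1.
  by move=> /HP[is_ _ _]; rewrite /trunc {1}(eqP is_) (flag_meet flagD) ?leq_pred.
have lev0 s : s \in P -> (0 < level s)%N by move=> /HP[_ ns _]; exact: level_gt0.
have [e [elt leU nleW]] : exists e, [/\ (e < (level p0).-1)%N, label U e & ~~ label W e].
  (* [trunc p0] has a label that [W] lacks, by strictness in the hypothesis. *)
  have : has (fun i => label U i && ~~ label W i) (iota 0 (level p0).-1).
    rewrite has_count lt0n; apply/eqP => c0.
    have := count_sub_le (label U) (label W) (iota 0 (level p0).-1).
    rewrite c0 addn0 -!(rank_label geoL flagD) -truncE //.
    have := rank_lt Wp0; have : (rank (W `&` D (level p0).-1) <= rank (W `&` D (level p0)))%N.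
      by rewrite rank_le // leI2 // (flag_le flagD) ?leq_pred.
    nat_lia.
  by move=> /hasP[e]; rewrite mem_iota add0n /= => ? /andP[? ?]; exists e.
pose q i := (i == e) || [exists p in P, (level p).-1 == i].
have Wq i : q i -> ~~ label W i.
  move=> /predU1P[->//|/exists_inP[p pP /eqP<-]]; have [_ _ Wp] := HP _ pP.
  rewrite /label prednK ?lev0 // negbK; apply/eqP/le_anti/andP; split.
    by rewrite lexI leIl (le_trans (ltW Wp)) ?leIr.
  by rewrite leI2 // (flag_le flagD) ?leq_pred.
have [X [leWX leXU labX]] := avoid_labels leWU Wq.
have q_count j : (count (label U) (iota 0 j) <=
    count (label X) (iota 0 j) + (#|[set p in P | ((level p).-1 < j)%N]|).+1)%N.
  apply: leq_trans (count_sub_le _ (label X) _) _; rewrite leq_add2l -size_filter.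
  have -> : #|[set p in P | ((level p).-1 < j)%N]|.+1 =
     size (e :: [seq (level p).-1 | p in [set p in P | ((level p).-1 < j)%N]]).
    by rewrite /= size_map -cardE.
  apply: uniq_leq_size; first by rewrite filter_uniq ?iota_uniq.
  move=> i; rewrite mem_filter mem_iota add0n labX => /andP[/andP[lU]].
  rewrite lU /= negbK => /predU1P[-> _|/exists_inP[p pP /eqP<-] lt]; rewrite inE ?eqxx //.
  by apply/orP; right; apply/imageP; exists p; rewrite ?inE ?pP.
exists X; split=> //.
- have := q_count n; rewrite -(rank_labels geoL flagD X) -(rank_labels geoL flagD U).
  have : (#|[set p in P | ((level p).-1 < n)%N]| <= #|P|)%N.
    by apply/subset_leq_card/subsetP => p; rewrite inE => /andP[].
  by have := rank_le leXU; nat_lia.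
- move=> s sP; have := rank_modular geoL X (trunc s); have := q_count (level s).-1.
  rewrite -!(rank_label geoL flagD) -truncE //.
  have -> : X `&` trunc s = X `&` D (level s).-1.
    by rewrite truncE // meetA (meet_l leXU).
  have : (#|[set p in P | ((level p).-1 < (level s).-1)%N]| <= #|[set p in P | prec p s]|)%N.
    apply/subset_leq_card/subsetP => p; rewrite !inE => /andP[pP lt]; rewrite pP andTb.
    have [ip _ _] := HP _ pP; have [is_ _ _] := HP _ sP.
    apply: (initial_prec flagD); last by apply: contraTneq lt => ->; rewrite ltnn.
    by apply: (initial_level flagD ip is_); nat_lia.
  nat_lia.
- move=> Z leXZ leZU.
  have [->|[p]] := set_0Vmem [set p in P | (p <= Z)%O]; first by rewrite cards0.
  rewrite inE => /andP[pP lepZ].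
  have lZ s : s \in P -> s <= Z -> label Z (level s).-1.
    move=> sP lesZ; apply: label_le lesZ _; have [_ ns _] := HP _ sP.
    rewrite /label prednK ?lev0 // (meet_l (le_level flagD s)).
    by have := trunc_lt flagD ns; rewrite lt_neqAle eq_sym => /andP[].
  have ep : (e < (level p).-1)%N by rewrite (leq_trans elt) //; have := p0min p pP; nat_lia.
  have leZ : label Z e.
    apply: label_le lepZ _; have [ip _ _] := HP _ pP.
    rewrite /label {1 2}(eqP ip) !(flag_meet flagD) //; nat_lia.
  have rZ : (count (label X) (iota 0 n) + (#|[set p in P | (p <= Z)%O]|).+1 <=
      count (label Z) (iota 0 n))%N.
    have -> : #|[set p in P | (p <= Z)%O]|.+1 =
     size (e :: [seq (level p).-1 | p in [set p in P | (p <= Z)%O]]).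
      by rewrite /= size_map -cardE.
    have cE s : count (label Z) s = (count (label X) s + size [seq i <- s | label Z i && ~~ label X i])%N.
      elim: s => //= i s ->; case lX: (label X i); first by rewrite (label_le leXZ lX) /=; nat_lia.
      by case: (label Z i) => /=; nat_lia.
    rewrite cE leq_add2l; apply: uniq_leq_size.
      rewrite /= map_inj_in_uniq ?enum_uniq ?andbT.
        apply/imageP => -[s]; rewrite inE => /andP[sP _] es.
        by move: elt; rewrite es; have := p0min s sP; nat_lia.
      move=> s t; rewrite !mem_enum !inE => /andP[sP _] /andP[tP _] est.
      have [is_ _ _] := HP _ sP; have [it _ _] := HP _ tP.
      by rewrite (eqP is_) (eqP it); congr (_ `&` D _); have := lev0 _ sP; have := lev0 _ tP; nat_lia.
    move=> i; rewrite mem_filter mem_iota add0n inE labX.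
    move=> /predU1P[->|/imageP[s]]; first by rewrite leZ /q eqxx andbF (label_lt flagD leZ).
    rewrite inE => /andP[sP sZ] ->.
    have -> : q (level s).-1 by apply/orP; right; apply/exists_inP; exists s.
    by rewrite andbF lZ // (label_lt flagD (lZ _ sP sZ)).
  by move: rZ; rewrite -(rank_labels geoL flagD X) -(rank_labels geoL flagD Z); nat_lia.
Qed.
End RunBase.

Local Open Scope ring_scope.

(** * Linear functionals on polynomials *)

Section LinearExtension.
Variables (n : nat) (f : 'X_{1..n} -> int).

Definition linext (p : {mpoly int[n]}) : int := \sum_(m <- msupp p) p@_m * f m.

Lemma linextE k p : (msize p <= k)%N ->
  linext p = \sum_(m : 'X_{1..n < k}) p@_m * f m.
Proof.
move=> pk; pose I : subFinType _ := 'X_{1..n < k}.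
rewrite /linext (big_mksub I) ?msupp_uniq //=; last first.
  by move=> m /msize_mdeg_lt /leq_trans; apply.
by rewrite big_rmcond //= => m /memN_msupp_eq0 ->; rewrite mul0r.
Qed.

Lemma linext_is_additive : additive linext.
Proof.
move=> p q; have [k [pk qk pqk]] : exists k, [/\ msize p <= k, msize q <= k & msize (p - q) <= k]%N.
  by exists (maxn (msize p) (maxn (msize q) (msize (p - q)))); split; lia.
rewrite !(@linextE k) // -sumrB; apply: eq_bigr => m _.
by rewrite mcoeffB mulrBl.
Qed.
HB.instance Definition _ := GRing.isAdditive.Build {mpoly int[n]} int linext linext_is_additive.

Lemma linextX m : linext 'X_[m] = f m.
Proof. by rewrite /linext msuppX big_seq1 mcoeffX eqxx mul1r. Qed.

Lemma linextZ c p : linext (c *: p) = c * linext p.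
Proof.
by rewrite -[in LHS](intz c) scaler_int raddfMz /= -mulrzl intz.
Qed.

Lemma linext_mul0 (q : {mpoly int[n]}) :
  (forall m, linext ('X_[m] * q) = 0) -> forall c, linext (c * q) = 0.
Proof.
move=> H c; rewrite [c]mpolyE mulr_suml raddf_sum big1 //= => m _.
by rewrite -scalerAl linextZ H mulr0.
Qed.
End LinearExtension.

(** Signs do not matter here: every monomial of the expanded product comes from
   a choice of [g] or [x] in each factor. *)
Lemma linext_prod_diff (I : eqType) (n : nat) (v : I -> 'I_n) (g : 'I_n) f
    (q : {mpoly int[n]}) (s : seq I) m :
    (forall T : seq I, subseq T s ->
      linext f ('X_[m + (\sum_(x <- T) U_(v x) + U_(g) *+ (size s - size T))] * q) = 0) ->
  linext f ('X_[m] * (\prod_(x <- s) ('X_g - 'X_(v x)) * q)) = 0.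
Proof.
elim: s m => [|x s IH] m H.
  by have := H [::] isT; rewrite !big_nil mul1r mulm0n !addm0.
rewrite big_cons; set P := \prod_(_ <- _) _.
have -> : 'X_[m] * (('X_g - 'X_(v x)) * P * q) =
    'X_[m + U_(g)] * (P * q) - 'X_[m + U_(v x)] * (P * q) by rewrite !mpolyXD; ring.
rewrite raddfB /= !IH ?subr0 // => T sT.
  have := H (x :: T); rewrite /= eqxx subSS => /(_ sT); congr (linext f ('X_[_] * _) = 0).
  by apply/mnmP => i; rewrite big_cons !mnmDE; lia.
have := H T (subseq_trans sT (subseq_cons _ _)); congr (linext f ('X_[_] * _) = 0).
by apply/mnmP => i; rewrite /= subSn ?size_subseq // mulmS !mnmDE; lia.
Qed.

(** * Loads of multisets and the coloop argument *)

Lemma uncross_arith (rE r1 r2 c1 c2 rj cj rm cm : nat) :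
  (r1 <= c1 + rE -> (r2 - rE).-1 < c2 -> rm + rj <= r1 + r2 -> rE <= rm ->
   c1 + c2 <= cj + cm -> cm <= (rm - rE).-1 -> rj <= cj + rE)%N.
Proof. lia. Qed.

Section HallRado.
Context {d : Order.disp_t} {L : finTBLatticeType d}.
Hypothesis geoL : geometric L.
Local Notation G := (Gmax L).
Local Notation mon := 'X_{1..#|G|}.
Implicit Types (E Z : L) (m : mon).

Definition inlevel E Z (x : G) := (val x <= Z)%O && ~~ (val x <= E)%O.

Definition load E Z m := (\sum_(x : G | inlevel E Z x) m (enum_rank x))%N.

Lemma load0 E Z : load E Z 0%MM = 0%N.
Proof. by rewrite /load big1 // => x _; rewrite mnm0E. Qed.

Lemma loadD E Z m1 m2 : load E Z (m1 + m2)%MM = (load E Z m1 + load E Z m2)%N.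
Proof. by rewrite /load -big_split; apply: eq_bigr => x _; rewrite mnmDE. Qed.

Lemma loadU E Z (x : G) : load E Z U_(enum_rank x)%MM = inlevel E Z x.
Proof.
rewrite /load; case: (boolP (inlevel E Z x)) => ix.
  rewrite (bigD1 x) //= mnm1E eqxx big1 // => y /andP[_ nyx].
  by rewrite mnm1E (inj_eq enum_rank_inj) eq_sym (negbTE nyx).
rewrite big1 // => y iy; rewrite mnm1E (inj_eq enum_rank_inj).
by case: eqVneq ix => // ->; rewrite iy.
Qed.

Lemma loadMn E Z m k : load E Z (m *+ k)%MM = (load E Z m * k)%N.
Proof.
by elim: k => [|k IH]; rewrite ?mulm0n ?load0 ?muln0 // mulmS loadD IH mulnS.
Qed.

Lemma load_sum E Z (T : seq G) :
  load E Z (\sum_(x <- T) U_(enum_rank x))%MM = count (inlevel E Z) T.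
Proof.
by elim: T => [|x T IH]; rewrite ?big_nil ?load0 // big_cons loadD loadU IH.
Qed.

(** Every factor counted on the left is counted at least as often on the right;
   the two different multisets are what the uncrossing of flats requires. *)
Lemma load_uncross E Z1 Z2 m m' : (forall i, (m i <= m' i)%N) ->
  (load E Z1 m' + load E Z2 m <=
   load E (Order.join Z1 Z2) m' + load E (Order.meet Z1 Z2) m)%N.
Proof.
move=> le; rewrite /load !(big_mkcond (inlevel _ _)) /= -!big_split /=.
apply: leq_sum => x _; have := le (enum_rank x); rewrite /inlevel lexI.
case: (boolP (val x <= E)%O); rewrite ?andbF ?andbT //= => _.
have jl : (val x <= Z1)%O || (val x <= Z2)%O -> (val x <= Order.join Z1 Z2)%O.
  by move=> /orP[]lx; rewrite (le_trans lx) ?leUl ?leUr.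
case l1: (val x <= Z1)%O jl; case l2: (val x <= Z2)%O => //= jl;
  by rewrite ?jl //= ?add0n ?addn0 // ?leq_add2l ?leq_addr.
Qed.

(** The dragon Hall-Rado condition for the multiset [m] in the interval from [E]
   to [E']. The tests run over flats rather than over submultisets: it is
   enough to test the largest submultiset below each flat, and its size is
   additive in [m]. *)
Definition fits E E' m :=
  forall Z, (E <= Z)%O -> (Z <= E')%O -> (load E Z m <= (rank Z - rank E).-1)%N.

Lemma fits_le E E' m m' : (forall i, (m i <= m' i)%N) -> fits E E' m' -> fits E E' m.
Proof.
move=> le fm' Z EZ ZE'; apply: leq_trans (fm' Z EZ ZE').
by rewrite /load; apply: leq_sum => x _.
Qed.

Local Notation msum T := (\sum_(x <- T) U_(enum_rank x))%MM.

(** Some element of [A] lies in no circuit of [A] and [R]. Otherwise each [x] in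
   [A] is below a flat where [R] and some other elements of [A] leave no room
   for [x]. Joining these flats one at a time, by submodularity, gives a flat
   above all of [A], hence above [g], whose load is at least its rank over [E].
   This contradicts the assumption on the copies of [g]. *)
Lemma coloop_exists E E' (g : G) (A : seq G) (R : mon) :
    (E <= E')%O -> inlevel E E' g -> uniq A ->
    (forall x, x \in A -> inlevel E (val g) x) ->
    (forall Z, (E <= Z)%O -> (forall x, x \in A -> (val x <= Z)%O) -> (val g <= Z)%O) ->
    fits E E' (R + U_(enum_rank g) *+ size A) ->
  exists2 x, x \in A & forall T, subseq T (rem x A) ->
    fits E E' (R + msum T) -> fits E E' (R + (U_(enum_rank x) + msum T)).
Proof.
move=> leEE' /andP[lgE' ngE] uA lA spanA fitg; apply: contrapT => Hno.
have tight (x : G) : x \in A -> exists T Z, [/\ subseq T (rem x A), (E <= Z)%O, (Z <= E')%O,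
    fits E E' (R + msum T) &
    ((rank Z - rank E).-1 < load E Z (R + (U_(enum_rank x) + msum T))%MM)%N].
  move=> xA; apply: contrapT => Hx; apply: Hno; exists x => // T sT fT Z EZ ZE'.
  apply: contrapT => /negP; by rewrite -ltnNge => lt; apply: Hx; exists T, Z.
have key (s : seq G) : {subset s <= A} -> exists Z, [/\ (E <= Z)%O, (Z <= E')%O,
    (forall x, x \in s -> (val x <= Z)%O) & (rank Z <= load E Z (R + msum A)%MM + rank E)%N].
  elim: s => [_|x s IH sA]; first by exists E; split=> //; lia.
  have sA' : {subset s <= A} by move=> y ys; apply: sA; rewrite inE ys orbT.
  have [Z1 [EZ1 Z1E' sZ1 r1]] := IH sA'.
  have xA : x \in A by apply: sA; rewrite mem_head.
  have [lxZ1|nxZ1] := boolP (val x <= Z1)%O.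
    by exists Z1; split=> // y; rewrite inE => /predU1P[->|/sZ1].
  have [T [Z2 [sT EZ2 Z2E' fT r2]]] := tight x xA.
  set m := (R + (U_(enum_rank x) + msum T))%MM in r2.
  have lem i : (m i <= (R + msum A)%MM i)%N.
    rewrite /m !mnmDE leq_add2l (perm_big _ (perm_to_rem xA)) big_cons mnmDE leq_add2l.
    rewrite !mnm_sumE.
    have /subseqP[msk _ ->] := sT; elim: (rem x A) msk => [|y t IHt] [|b msk] //=.
      by rewrite big_nil.
    by case: b; rewrite ?big_cons ?leq_add2l // (leq_trans (IHt msk)) ?leq_addl.
  have lx2 : (val x <= Z2)%O.
    apply: contraT => nx2; move: r2.
    rewrite /m !loadD loadU /inlevel (negbTE nx2) /= add0n -loadD.
    by rewrite ltnNge fT.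
  exists (Order.join Z1 Z2); split.
  - by rewrite (le_trans EZ1) ?leUl.
  - by rewrite leUx Z1E'.
  - move=> y; rewrite inE => /predU1P[->|/sZ1 le]; first by rewrite (le_trans lx2) ?leUr.
    by rewrite (le_trans le) ?leUl.
  have EZ12 : (E <= Order.meet Z1 Z2)%O by rewrite lexI EZ1.
  have Z12E' : (Order.meet Z1 Z2 <= E')%O by rewrite (le_trans (leIl _ _)).
  have := fT _ EZ12 Z12E'; have := load_uncross E Z1 Z2 lem.
  have -> : load E (Order.meet Z1 Z2) m = load E (Order.meet Z1 Z2) (R + msum T)%MM.
    by rewrite /m !loadD loadU /inlevel lexI (negbTE nxZ1).
  exact: uncross_arith r1 r2 (rank_modular geoL Z1 Z2) (rank_le EZ12).
have [Z [EZ ZE' AZ rZ]] := key A (fun x => id).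
have gZ := spanA Z EZ AZ; have := fitg Z EZ ZE'; move: rZ.
rewrite !loadD loadMn loadU load_sum /inlevel gZ ngE mul1n.
have -> : count (fun x : G => (val x <= Z)%O && ~~ (val x <= E)%O) A = size A.
  by apply/eqP; rewrite -all_count; apply/allP => x xA; rewrite AZ //; case/andP: (lA x xA).
have : (rank E < rank Z)%N.
  by apply: rank_lt; rewrite lt_neqAle EZ andbT; apply: contraNneq ngE => ->.
nat_lia.
Qed.
End HallRado.

(** * The functional of a flag kills the ideal *)

Section FlagFunctional.
Context {d : Order.disp_t} {L : finTBLatticeType d}.
Hypothesis geoL : geometric L.
Local Notation G := (Gmax L).
Local Notation mon := 'X_{1..#|G|}.
Variables (F : nat -> L) (live : pred nat) (N k : nat).
Hypothesis F0 : F 0%N = \bot%O.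
Hypothesis FN : F N = \top%O.
Hypothesis Fle : forall i, (F i <= F i.+1)%O.
Local Notation msum T := (\sum_(x <- T) U_(enum_rank x))%MM.

(** The degrees of freedom of the functional are a chain [F] of flats and the
   set of its live intervals: factors in the other intervals are killed, which
   corresponds to the degree 0 part of the Chow rings of these intervals. *)
Definition admissible (m : mon) : Prop :=
  (forall j, if live j then fits (F j) (F j.+1) m
             else load (F j) (F j.+1) m = 0%N) /\ mdeg m = k.

Definition flag_functional : {mpoly int[#|G|]} -> int :=
  linext (fun m => (`[< admissible m >] : nat)%:Z).

Lemma functional0 m : ~ admissible m -> flag_functional 'X_[m] = 0.
Proof. by rewrite /flag_functional linextX => /asboolF ->. Qed.

Lemma functional1 m : admissible m -> flag_functional 'X_[m] = 1.
Proof. by rewrite /flag_functional linextX => /asboolT ->. Qed.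

Lemma functional_eq m m' : (admissible m <-> admissible m') ->
  flag_functional 'X_[m] = flag_functional 'X_[m'].
Proof. by rewrite /flag_functional !linextX => /asbool_equiv_eq ->. Qed.

Lemma F_le i j : (i <= j)%N -> (F i <= F j)%O.
Proof. exact: (@homo_leq _ F (fun x y => (x <= y)%O) (@lexx _ _) (@le_trans _ _)). Qed.

Lemma inlevel_ex (x : G) : exists j, inlevel (F j) (F j.+1) x.
Proof.
have : exists j, (val x <= F j)%O by exists N; rewrite FN lex1.
move=> /ex_minnP[[|j] lej minj].
  by move: lej (valP x); rewrite F0 lex0 => ->.
by exists j; rewrite /inlevel lej /=; apply/negP => /minj; rewrite ltnn.
Qed.

Lemma inlevel_ne (x : G) i j Z : inlevel (F j) (F j.+1) x -> i != j ->
  (Z <= F i.+1)%O -> inlevel (F i) Z x = false.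
Proof.
move=> /andP[xj nxj] nij leZ; apply/negP => /andP[xZ nxi].
have [ltij|] := ltnP i j.
  by case/negP: nxj; rewrite (le_trans xZ) // (le_trans leZ) // F_le.
rewrite leq_eqVlt eq_sym (negbTE nij) /= => ltji.
by case/negP: nxi; rewrite (le_trans xj) // F_le.
Qed.

Lemma admissible_swap (x y : G) j m : inlevel (F j) (F j.+1) x -> inlevel (F j) (F j.+1) y ->
    live j -> (fits (F j) (F j.+1) (m + U_(enum_rank x)) -> fits (F j) (F j.+1) (m + U_(enum_rank y))) ->
  admissible (m + U_(enum_rank x)) -> admissible (m + U_(enum_rank y)).
Proof.
move=> lx ly lj fxy [adm deg]; split; last by rewrite -deg !mdegD !mdeg1.
move=> i; have := adm i; have [->|nij] := eqVneq i j; first by rewrite lj.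
have eqload Z : (Z <= F i.+1)%O ->
    load (F i) Z (m + U_(enum_rank x)) = load (F i) Z (m + U_(enum_rank y)).
  by move=> le; rewrite !loadD !loadU (inlevel_ne lx) ?(inlevel_ne ly).
case: ifP => _; last by rewrite eqload.
by move=> H Z FZ ZF; rewrite -eqload // H.
Qed.

Lemma dead_load (m : mon) j : ~~ live j -> (0 < load (F j) (F j.+1) m)%N -> ~ admissible m.
Proof. by move=> /negbTE dj lt [/(_ j)]; rewrite dj => e; move: lt; rewrite e. Qed.

(** If the copies of [g] do not fit, no term of the product fits, because [g] is
   above all of [A]. If they fit, the factor of a coloop [x] is set apart: the
   two terms that differ by the exchange of [g] and [x] cancel. *)
Lemma functional_prod0 (g : G) (A : seq G) j : inlevel (F j) (F j.+1) g ->
    uniq A -> A != [::] -> (forall x, x \in A -> inlevel (F j) (val g) x) ->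
    (forall Z, (F j <= Z)%O -> (forall x, x \in A -> (val x <= Z)%O) -> (val g <= Z)%O) ->
  forall c, flag_functional (c * \prod_(x <- A) (hvar g - hvar x)) = 0.
Proof.
move=> lg uA An0 lA spanA; apply: linext_mul0 => R; have /andP[lgF ngF] := lg.
have lAF x : x \in A -> inlevel (F j) (F j.+1) x.
  by move=> /lA /andP[xg nx]; rewrite /inlevel nx (le_trans xg).
have cntA T : {subset T <= A} -> count (inlevel (F j) (F j.+1)) T = size T.
  by move=> sT; apply/eqP; rewrite -all_count; apply/allP => x /sT/lAF.
have cntZ T Z : {subset T <= A} -> (val g <= Z)%O -> count (inlevel (F j) Z) T = size T.
  move=> sT gZ; apply/eqP; rewrite -all_count; apply/allP => x /sT/lA /andP[xg nx].
  by rewrite /inlevel nx (le_trans xg).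
have gE Z : inlevel (F j) Z g = (val g <= Z)%O by rewrite /inlevel ngF andbT.
have [lj|dj] := boolP (live j); last first.
  rewrite -[\prod_(_ <- _) _]mulr1; apply: linext_prod_diff => T sT.
  rewrite mulr1; apply: functional0; apply: (dead_load dj).
  have TA : {subset T <= A} by exact: mem_subseq.
  rewrite !loadD loadMn loadU lg load_sum cntA //= mul1n subnKC ?size_subseq //.
  by case: (A) An0 => //= *; rewrite addnS.
have [fitg|nfitg] := pselect (fits (F j) (F j.+1) (R + U_(enum_rank g) *+ size A)); last first.
  rewrite -[\prod_(_ <- _) _]mulr1; apply: linext_prod_diff => T sT.
  rewrite mulr1; apply: functional0 => -[/(_ j)]; rewrite lj => fitT _.
  apply: nfitg => Z FZ ZF.
  have TA : {subset T <= A} by exact: mem_subseq.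
  have := fitT Z FZ ZF; rewrite !loadD !loadMn !loadU gE load_sum.
  have [gZ|_] := boolP (val g <= Z)%O; last by nat_lia.
  by rewrite cntZ //= !mul1n subnKC ?size_subseq.
have [x xA coloop] := coloop_exists geoL (Fle j) lg uA lA spanA fitg.
rewrite (perm_big _ (perm_to_rem xA)) big_cons /= [X in 'X_[R] * X]mulrC.
apply: linext_prod_diff => T sT; rewrite mulrBr -!mpolyXD raddfB.
set M := (R + (_ + _))%MM.
have TA : {subset T <= A} by move=> y /(mem_subseq sT) /mem_rem.
have xTA : {subset x :: T <= A} by move=> y; rewrite inE => /predU1P[->//|/TA].
have szA : size (rem x A) = (size A).-1 by rewrite size_rem.
have szA0 : (0 < size A)%N by case: (A) An0.
have szT : (size T <= (size A).-1)%N by rewrite -szA size_subseq.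
have eqM Z : (val g <= Z)%O -> (load (F j) Z M).+1 = load (F j) Z (R + U_(enum_rank g) *+ size A).
  move=> gZ; rewrite /M !loadD !loadMn loadU gE gZ load_sum cntZ // szA !mul1n subnKC // -addnS prednK // mul1n.
apply/eqP; rewrite subr_eq0; apply/eqP/functional_eq; split.
  apply: (admissible_swap lg (lAF _ xA) lj) => fitM Z FZ ZF.
  have [gZ|ngZ] := boolP (val g <= Z)%O.
    have := fitg Z FZ ZF; rewrite -eqM // [load _ _ (M + _)]loadD loadU.
    have /andP[xg nx] := lA _ xA; rewrite /inlevel nx (le_trans xg gZ) /=; nat_lia.
  have fitT : fits (F j) (F j.+1) (R + msum T).
    by apply: fits_le fitM => i; rewrite /M !mnmDE -!addnA leq_add2l leq_addr.
  have := coloop T sT fitT Z FZ ZF.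
  rewrite /M !loadD loadMn !loadU gE (negbTE ngZ) mul0n addn0 => le.
  by rewrite -addnA [X in (_ + X)%N]addnC.
apply: (admissible_swap (lAF _ xA) lg lj) => fitM Z FZ ZF.
have [gZ|ngZ] := boolP (val g <= Z)%O.
  by have := fitg Z FZ ZF; rewrite -eqM // [load _ _ (M + _)]loadD loadU gE gZ addn1.
have := fitM Z FZ ZF; rewrite ![load _ _ (M + _)]loadD !loadU gE (negbTE ngZ); nat_lia.
Qed.

(** Only the factors of the antichain that are in the same interval of the chain
   as [g] are used; they already span [g] over the lower end of the interval. *)
Lemma functional_relation r : wond_relation r -> forall c, flag_functional (c * r) = 0.
Proof.
case=> [H atomH|g A _ defg].
  apply: linext_mul0 => m; rewrite /hvar -mpolyXD; apply: functional0.
  have [j lH] := inlevel_ex H; have [lj|dj] := boolP (live j); last first.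
    by apply: (dead_load dj); rewrite loadD loadU lH addn1.
  have /andP[HF nHF] := lH.
  move=> [/(_ j)]; rewrite lj => /(_ (Order.join (F j) (val H)) (leUl _ _)).
  rewrite leUx Fle HF (rank_join_atom geoL atomH nHF) subSnn loadD loadU /inlevel nHF leUr => /(_ isT) le.
  by move: le; nat_lia.
have [j lg] := inlevel_ex g; have /andP[gF ngF] := lg.
pose Aj := [set X in A | ~~ (val X <= F j)%O].
move=> c; rewrite (bigID [pred X | X \in Aj]) /= mulrCA mulrC.
rewrite (_ : \prod_(i in A | i \in Aj) _ = \prod_(x <- enum Aj) (hvar g - hvar x)); last first.
  rewrite big_enum; apply: eq_bigl => x /=; rewrite !inE; case: (x \in A) => //=.
have leA X : X \in A -> (val X <= val g)%O by move=> XA; rewrite -defg joins_sup.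
have spanA Z : (F j <= Z)%O -> (forall x, x \in enum Aj -> (val x <= Z)%O) -> (val g <= Z)%O.
  move=> FZ AZ; rewrite -defg; apply/joinsP => X XA.
  have [XF|nXF] := boolP (val X <= F j)%O; first exact: le_trans FZ.
  by apply: AZ; rewrite mem_enum inE XA.
apply: (functional_prod0 lg) => //; first exact: enum_uniq.
  apply: contraNneq ngF => A0; apply: spanA => //.
  by move=> x; rewrite A0.
by move=> x; rewrite mem_enum inE => /andP[/leA xg nx]; rewrite /inlevel nx xg.
Qed.

Lemma functional_ideal p : generated_ideal (@wond_relation d L) p -> flag_functional p = 0.
Proof.
move=> [n [c [r [relr ->]]]]; rewrite /flag_functional raddf_sum big1 // => i _.
exact: functional_relation.
Qed.
End FlagFunctional.

(** * The flag of a standard monomial *)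

Section StandardFlag.
Context {d : Order.disp_t} {L : finTBLatticeType d}.
Local Open Scope order_scope.
Hypothesis geoL : geometric L.
Variable D : nat -> L.
Hypothesis flagD : modular_flag D.
Local Notation level := (level D).
Local Notation trunc := (trunc D).
Local Notation initial := (initial D).
Local Notation prec := (prec D).
Local Notation compatible := (compatible D).
Local Notation G := (Gmax L).

Variable t : seq L.
Hypothesis t_trunc : forall x, x \in t -> \bot < trunc x.
Hypothesis t_prec : forall i l, (i < l < size t)%N -> prec (nth \bot t l) (nth \bot t i).
Hypothesis t_compat : forall i l, (i < l < size t)%N -> compatible (nth \bot t l) (nth \bot t i).

Local Notation t_ i := (nth \bot t i).

Definition partial_join i : L := \join_(x <- take i t) x.
Local Notation V := partial_join.

Lemma partial_joinS i : (i < size t)%N -> V i.+1 = t_ i `|` V i.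
Proof.
by move=> lt; rewrite /V (take_nth \bot lt) -cats1 big_cat big_seq1 /= joinC.
Qed.

Lemma partial_join_over i : (size t <= i)%N -> V i.+1 = V i.
Proof. by move=> le; rewrite /V !take_oversize // ltnW. Qed.

Lemma partial_join_leS i : V i <= V i.+1.
Proof.
by case: (ltnP i (size t)) => [/partial_joinS->|/partial_join_over->]; rewrite ?leUr.
Qed.

Lemma partial_join_le i j : (i <= j)%N -> V i <= V j.
Proof.
exact: (@homo_leq _ V (fun x y => x <= y) (@lexx _ _) (@le_trans _ _) partial_join_leS).
Qed.

Lemma le_partial_join l i : (l < i)%N -> (l < size t)%N -> t_ l <= V i.
Proof.
move=> li lt; apply: le_trans (partial_join_le li).
by rewrite partial_joinS // leUl.
Qed.

Lemma compatible_partial_join i l : (i <= l < size t)%N -> compatible (t_ l) (V i).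
Proof.
elim: i l => [|i IH] l /andP[il lt].
  by rewrite /compatible /V take0 big_nil meet0x t_trunc ?orbT ?mem_nth.
rewrite partial_joinS; last by rewrite (ltn_trans il).
apply: (compatible_join geoL flagD).
- by apply: t_compat; rewrite il.
- by apply: IH; rewrite ltnW.
- by apply: IH; rewrite leqnn (ltn_trans il).
apply/negP => ini; have lp : prec (t_ l) (t_ i) by apply: t_prec; rewrite il.
have := initial_prec flagD ini; case: eqP => [e|_ /(_ isT)].
  by move: lp; rewrite e prec_irr.
by apply/negP/prec_asym.
Qed.

Definition group i : {set L} := [set s | [&& s \in t, s <= V i.+1 & ~~ (s <= V i)]].

(** An element of the group occurs in [t] at or after position [i], so
   [compatible_partial_join] applies to it; the element at position [i] itself
   is initial in the new join by [compatible_initial]. *)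
Lemma group_run i s : s \in group i ->
  [/\ initial s (V i.+1), s != \bot & V i `&` D (level s) < trunc s].
Proof.
rewrite inE => /and3P[st sV nsV].
have s0 : s != \bot.
  by apply: contraTneq (t_trunc st) => ->; rewrite /trunc meet0x ltxx.
have [l lt es] : exists2 l, (l < size t)%N & s = t_ l.
  by exists (index s t); rewrite ?index_mem ?nth_index.
have il : (i <= l)%N.
  by rewrite leqNgt; apply: contra nsV => li; rewrite es le_partial_join.
have cV : compatible s (V i) by rewrite es compatible_partial_join ?il.
split=> //; last first.
  case/orP: cV => // /eqP e; case/negP: nsV; rewrite -{1}e; exact: leIl.
have [eil|nil] := eqVneq i l.
  rewrite partial_joinS ?eil // -es; apply: (compatible_initial geoL flagD).
  by rewrite -eil.
have : compatible s (V i.+1) by rewrite es compatible_partial_join // lt andbT ltn_neqAle nil il.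
case/orP => [/eqP/esym/eqP//|lt'].
have : s < s.
  apply: le_lt_trans (lt_le_trans lt' (trunc_le D s)).
  by rewrite lexI sV (le_level flagD).
by rewrite ltxx.
Qed.

Lemma bases_exist : exists X : nat -> L, forall i, [/\ V i <= X i, X i <= V i.+1,
    ((rank (V i.+1) - rank (X i)).-1 <= #|group i|)%N,
    forall s, s \in group i ->
      ((rank (X i `|` trunc s) - rank (X i)).-1 <= #|[set p in group i | prec p s]|)%N
    & forall Z, X i <= Z -> Z <= V i.+1 ->
      (#|[set p in group i | (p <= Z)%O]| <= (rank Z - rank (X i)).-1)%N].
Proof.
have ex i := run_base geoL flagD (partial_join_leS i) (@group_run i).
by have [X HX] := boolp.choice ex; exists X => i; exact: HX.
Qed.

Lemma group_disjoint i j s : s \in group i -> s \in group j -> i = j.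
Proof.
wlog: i j / (i <= j)%N => [H|]; first by case: (leqP i j) => [|/ltnW] le si sj; [|apply/esym]; apply: H.
rewrite leq_eqVlt => /predU1P[//|lt]; rewrite !inE => /and3P[_ sV _] /and3P[_ _ /negP[]].
exact: le_trans (partial_join_le lt).
Qed.

Definition support_mnm : 'X_{1..#|G|} := (\sum_(x : G | val x \in t) U_(enum_rank x))%MM.

Lemma load_support E Z :
  load E Z support_mnm = #|[set s in t | [&& s != \bot, s <= Z & ~~ (s <= E)]]|.
Proof.
rewrite /support_mnm big_mkcond -big_enum /=.
have -> : load E Z (\sum_(x <- enum G) (if val x \in t then U_(enum_rank x) else 0))%MM =
   count (fun x : G => (val x \in t) && inlevel E Z x) (enum G).
  by elim: (enum G) => [|x s IH]; rewrite ?big_nil ?load0 // big_cons loadD IH /=; case: ifP => _; rewrite ?loadU ?load0.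
rewrite -size_filter -(size_map (val : G -> L)) cardE; apply/perm_size/uniq_perm.
- by rewrite (map_inj_uniq val_inj) filter_uniq ?enum_uniq.
- exact: enum_uniq.
move=> s; rewrite mem_enum inE; apply/mapP/and4P => [[x]|[st s0 sZ sE]].
  by rewrite mem_filter => /andP[/andP[xt /andP[xZ xE]] _] ->; split=> //; exact: (valP x).
by exists (exist _ s s0); rewrite // mem_filter mem_enum /inlevel /= st sZ sE.
Qed.

Lemma mdeg_support : mdeg support_mnm = #|[set s in t]|.
Proof.
have -> : mdeg support_mnm = load \bot \top support_mnm.
  rewrite mdegE (reindex (@enum_rank G)) /=; last exact: (onW_bij _ (enum_rank_bij _)).
  by apply: eq_bigl => x; rewrite /inlevel lex1 lex0 (valP x).
rewrite load_support; apply: eq_card => s; rewrite !inE lex1 lex0.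
case: (boolP (s \in t)) => //= st; rewrite andbb.
by apply: contraTneq (t_trunc st) => ->; rewrite /trunc meet0x ltxx.
Qed.

(** If [s] is the first element of the group not before [v], then everything
   before [v] below [V i.+1] is an initial segment of [V i.+1] contained in
   [trunc s], so the test at the flat spanned by [trunc s] bounds its number. *)
Lemma group_prec i X (m : 'X_{1..#|G|}) v :
    X <= V i.+1 -> ((rank (V i.+1) - rank X).-1 <= #|group i|)%N ->
    (forall s, s \in group i ->
      ((rank (X `|` trunc s) - rank X).-1 <= #|[set p in group i | prec p s]|)%N) ->
    fits X (V i.+1) m ->
  (\sum_(y : G | inlevel X (V i.+1) y && prec (val y) v) m (enum_rank y)
     <= #|[set p in group i | prec p v]|)%N.
Proof.
move=> XV cg ctr fm.
have [|/existsPn none] := boolP [exists s in group i, ~~ prec s v]; last first.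
  have -> : [set p in group i | prec p v] = group i.
    apply/setP => p; rewrite inE andb_idr // => pg.
    by have := none p; rewrite pg negbK.
  apply: leq_trans cg; apply: leq_trans (fm _ XV (lexx _)).
  by rewrite /load big_mkcondr /=; apply: leq_sum => y _; case: ifP.
move=> /existsP[s0 Ps0].
case: (@arg_minnP _ s0 (fun s => (s \in group i) && ~~ prec s v) level Ps0) => s /andP[sg nsv] smin.
have [is_ _ _] := group_run sg.
have XtV : X `|` trunc s <= V i.+1.
  by rewrite leUx XV (le_trans (trunc_le D s)) // (initial_le is_).
have le_sum : (\sum_(y : G | inlevel X (V i.+1) y && prec (val y) v) m (enum_rank y) <=
    load X (X `|` trunc s) m)%N.
  rewrite /load [leqRHS]big_mkcond [leqLHS]big_mkcond /=; apply: leq_sum => y _.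
  case: ifP => // /andP[/andP[yV nyX] yv]; rewrite ifT // /inlevel nyX andbT.
  have ys : prec (val y) s.
    have [esv|nesv] := eqVneq s v; first by rewrite esv.
    by have := prec_total D nesv; rewrite (negbTE nsv) => /(prec_trans yv).
  have iy : initial (val y) (V i.+1).
    apply: contraT => /(noninitial_prec geoL flagD yV) Vy.
    have : prec s (val y).
      have [->//|nsV] := eqVneq s (V i.+1).
      exact: prec_trans (initial_prec flagD is_ nsV) Vy.
    by move=> /prec_asym; rewrite ys.
  have nys : val y != s by apply: contraTneq ys => ->; rewrite prec_irr.
  rewrite (le_trans _ (leUr _ _)) //; apply: (initial_lt_trunc flagD iy is_).
  rewrite lt_neqAle nys /=; apply: initial_le; apply: (initial_level flagD iy is_).
  rewrite leqNgt; apply/negP => lt.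
  have := initial_prec flagD (initial_level flagD is_ iy (ltnW lt)).
  by rewrite eq_sym nys => /(_ isT) /prec_asym; rewrite ys.
apply: leq_trans le_sum _; apply: leq_trans (fm _ (leUl _ _) XtV) _.
apply: leq_trans (ctr _ sg) _; apply/subset_leq_card/subsetP => p.
rewrite in_set => /andP[pg ps]; rewrite in_set pg andTb; apply: contraLR ps => npv.
have lev : (level s <= level p)%N by apply: smin; rewrite pg.
have [ip _ _] := group_run pg.
have := initial_prec flagD (initial_level flagD is_ ip lev).
have [->|_ /(_ isT) /prec_asym//] := eqVneq s p.
by rewrite prec_irr.
Qed.

Local Notation k := (size t).

(** The chain alternates the partial joins and the flats chosen by [run_base];
   the intervals from such a flat to the next partial join are live. *)
Lemma standard_flag : exists F live N, [/\
    [/\ F 0%N = \bot, F N = \top & forall i, F i <= F i.+1],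
    admissible F live #|[set s in t]| support_mnm
  & forall m v, admissible F live #|[set s in t]| m ->
    (\sum_(y : G | prec (val y) v) m (enum_rank y) <= #|[set p in t | prec p v]|)%N].
Proof.
have [X HX] := bases_exist.
pose F j := if (j < k.*2.+1)%N then (if odd j then X j./2 else V j./2) else \top.
pose live j := odd j && (j < k.*2)%N.
have Fodd i : (i < k)%N -> F i.*2.+1 = X i.
  by move=> ik; rewrite /F ltnS ltn_double ik /= odd_double /= uphalf_double.
have Feven i : (i <= k)%N -> F i.*2 = V i.
  by move=> ik; rewrite /F ltnS leq_double ik odd_double doubleK.
have Ftop j : (k.*2 < j)%N -> F j = \top by move=> lt; rewrite /F ltnNge lt.
have cases j : [\/ exists2 i, (i < k)%N & j = i.*2, exists2 i, (i < k)%N & j = i.*2.+1 | (k.*2 <= j)%N].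
  have [lt|] := ltnP j k.*2; last by constructor 3.
  have := odd_double_half j; case: (odd j) => e; [constructor 2|constructor 1]; exists j./2; nat_lia.
have tV s : s \in t -> s <= V k.
  by move=> st; rewrite -(nth_index \bot st) le_partial_join ?index_mem.
exists F, live, k.*2.+1; split.
- split; first by rewrite -[0%N]/(0.*2) Feven // /V take0 big_nil.
    by rewrite Ftop.
  move=> j; have [[i ik ->]|[i ik ->]|kj] := cases j.
  + by rewrite Fodd // Feven ?(ltnW ik) //; have [] := HX i.
  + by rewrite -doubleS Fodd // Feven //; have [] := HX i.
  + by rewrite (Ftop j.+1) ?lex1.
- split; last exact: mdeg_support.
  move=> j; have [[i ik ->]|[i ik ->]|kj] := cases j.
  + rewrite /live odd_double /= Fodd // Feven ?(ltnW ik) // load_support.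
    have [VX XV _ _ /(_ _ (lexx _) XV)] := HX i; rewrite subnn leqn0 => /eqP c0.
    apply/eqP; rewrite -leqn0 -c0; apply/subset_leq_card/subsetP => s; rewrite !inE.
    by move=> /and4P[-> _ sX ->]; rewrite sX (le_trans sX).
  + rewrite /live /= odd_double -doubleS ltn_Sdouble ik /= Fodd // Feven //.
    have [VX XV _ _ cZ] := HX i => Z XZ ZV; apply: leq_trans (cZ Z XZ ZV).
    rewrite load_support; apply/subset_leq_card/subsetP => s; rewrite !inE.
    move=> /and4P[-> _ sZ nsX]; rewrite sZ (le_trans sZ) //= andbT.
    by apply: contra nsX => sV; exact: le_trans VX.
  + rewrite /live ltnNge kj andbF load_support; apply/eqP.
    rewrite cards_eq0; apply/eqP/setP => s; rewrite !inE; apply/negP => /and4P[st _ _ /negP[]].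
    move: kj; rewrite leq_eqVlt => /predU1P[<-|lt]; last by rewrite Ftop ?lex1.
    by rewrite Feven ?tV.
move=> m v [adm _].
have F0 : F 0%N = \bot by rewrite -[0%N]/(0.*2) Feven // /V take0 big_nil.
have FN : F k.*2.+1 = \top by rewrite Ftop.
have live_level (y : G) : (0 < m (enum_rank y))%N -> exists2 i : 'I_k, true & inlevel (X i) (V i.+1) y.
  move=> my; have [j ly] := inlevel_ex F0 FN y.
  have pos : (0 < load (F j) (F j.+1) m)%N by rewrite /load (bigD1 y) //= ltn_addr.
  have := adm j; have [[i ik ej]|[i ik ej]|kj] := cases j.
  + by rewrite /live ej odd_double /= -ej => e; move: pos; rewrite e.
  + by move=> _; exists (Ordinal ik); rewrite //= -(Fodd i) // -(Feven i.+1) // doubleS -ej.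
  + by rewrite /live ltnNge kj andbF => e; move: pos; rewrite e.
apply: (@leq_trans (\sum_(i < k) \sum_(y : G | inlevel (X i) (V i.+1) y && prec (val y) v) m (enum_rank y))).
  under [leqRHS]eq_bigr => i _ do rewrite big_mkcond.
  rewrite exchange_big /= big_mkcond /=; apply: leq_sum => y _; case: ifP => // yv.
  have [->//|my] := posnP (m (enum_rank y)).
  have [i _ li] := live_level y my.
  by rewrite (bigD1 i) //= li /= leq_addr.
apply: (@leq_trans (\sum_(i < k) #|[set p in group i | prec p v]|)).
  apply: leq_sum => i _; have [VX XV cg ctr _] := HX i; apply: group_prec => //.
  have := adm i.*2.+1; rewrite /live /= odd_double -doubleS ltn_Sdouble ltn_ord /=.
  by rewrite Fodd // Feven.
have -> : (\sum_(i < k) #|[set p in group i | prec p v]| =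
   \sum_(s in [set p in t | prec p v]) \sum_(i < k) (s \in group i))%N.
  rewrite exchange_big /=; apply: eq_bigr => i _; rewrite -sum1_card big_mkcond [RHS]big_mkcond /=.
  apply: eq_bigr => s _; rewrite !inE; case: (s \in t) => //=.
  by case: (prec s v); rewrite ?andbF ?andbT //=; case: (_ && _).
rewrite -sum1_card; apply: leq_sum => s _.
have [/existsP[i si]|/existsPn none] := boolP [exists i : 'I_k, s \in group i].
  rewrite (bigD1 i) //= si big1 // => j nji; apply/eqP; rewrite eqb0; apply: contra nji => sj.
  exact/eqP/val_inj/(group_disjoint sj si).
by rewrite big1 // => i _; rewrite (negbTE (none i)).
Qed.
End StandardFlag.

(** * Rewriting products in the Chow ring *)

Section Morphisms.

Lemma mpoly_rmorph_eq n (S : comNzRingType) (f g : {rmorphism {mpoly int[n]} -> S}) :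
  (forall i, f 'X_i = g 'X_i) -> f =1 g.
Proof.
move=> fg p; rewrite [p]mpolyE !rmorph_sum; apply: eq_bigr => m _ /=.
rewrite -mul_mpolyC !rmorphM mpolyXE_id !rmorph_prod.
rewrite -[p@_m]intz [(_%:~R)%:MP](rmorph_int (@mpolyC n int)) !rmorph_int; congr (_ * _).
by apply: eq_bigr => i _; rewrite !rmorphXn /= fg.
Qed.
End Morphisms.

Section ChowRing.
Context {d : Order.disp_t} {L : finTBLatticeType d}.
Local Notation G := (Gmax L).
Local Notation FY := (FYmax L).

Definition FYproj : wond_polyring L -> FY := \pi_({ideal_quot (@wond_ideal d L)})%qT.

Lemma FYproj_zmod : zmod_morphism FYproj. Proof. by move=> x y; rewrite /FYproj rmorphB. Qed.
Lemma FYproj_monoid : monoid_morphism FYproj.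
Proof. by split; [rewrite /FYproj rmorph1 | move=> x y; rewrite /FYproj rmorphM]. Qed.
HB.instance Definition _ := GRing.isZmodMorphism.Build (wond_polyring L) FY FYproj FYproj_zmod.
HB.instance Definition _ := GRing.isMonoidMorphism.Build (wond_polyring L) FY FYproj FYproj_monoid.

Lemma FYproj_eq0 q : FYproj q = 0 <-> generated_ideal (@wond_relation d L) q.
Proof.
have E : FYproj q = 0 <-> q \in @wond_ideal d L.
  rewrite -[q in q \in _]subr0 Quotient.idealrBE; split=> [e|/eqP e].
    by apply/eqP; rewrite -[LHS]/(FYproj q) e -[RHS]/(FYproj 0) rmorph0.
  by rewrite -(rmorph0 FYproj).
by rewrite E; split=> /asboolP.
Qed.

Lemma FYproj_surj a : exists q, FYproj q = a.
Proof. by exists (repr a); rewrite /FYproj reprK. Qed.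

Definition flat_class (y : L) : FY := if insub y is Some x then FYh (x : G) else 0.

Lemma flat_classE (x : G) : flat_class (val x) = FYh x.
Proof. by rewrite /flat_class valK. Qed.

Lemma FYh_atom (x : G) : atom (val x) -> FYh x = 0.
Proof.
move=> ax; apply/(FYproj_eq0 (hvar x)); exists 1%N, (fun=> 1), (fun=> hvar x).
by rewrite big_ord1 mul1r; split=> // _; constructor.
Qed.

Lemma flat_class_atom a : atom a -> flat_class a = 0.
Proof. by rewrite /flat_class; case: insubP => // x _ <-; exact: FYh_atom. Qed.

Lemma flat_class_incomparable (x y : L) : ~~ (x <= y)%O -> ~~ (y <= x)%O ->
  (flat_class (Order.join x y) - flat_class x) * (flat_class (Order.join x y) - flat_class y) = 0.
Proof.
move=> nxy nyx; set z := Order.join x y.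
have x0 : x != \bot%O by apply: contraNneq nxy => ->; rewrite le0x.
have y0 : y != \bot%O by apply: contraNneq nyx => ->; rewrite le0x.
have z0 : z != \bot%O by apply: contraNneq x0 => e; rewrite -lex0 -e leUl.
pose X : G := exist _ x x0; pose Y : G := exist _ y y0; pose Z : G := exist _ z z0.
rewrite -[x]/(val X) -[y]/(val Y) -[z]/(val Z) !flat_classE.
rewrite -[FYh X]/(FYproj (hvar X)) -[FYh Y]/(FYproj (hvar Y)) -[FYh Z]/(FYproj (hvar Z)).
rewrite -!rmorphB -rmorphM; apply/FYproj_eq0.
have nXY : X != Y by apply: contraNneq nxy => /(congr1 val) /= ->; rewrite lexx.
have rel : wond_relation (\prod_(T in [set X; Y]) (hvar Z - hvar T)).
  apply: WondAntichain; last by rewrite big_setU1 ?inE // big_set1.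
  apply/'forall_in_forall_inP => u /set2P[]-> v /set2P[]->; rewrite ?eqxx ?implybT //=.
    by rewrite (negbTE nxy).
  by rewrite (negbTE nyx).
move: rel; rewrite big_setU1 ?inE // big_set1 => rel.
exists 1%N, (fun=> 1), (fun=> (hvar Z - hvar X) * (hvar Z - hvar Y)).
by rewrite big_ord1 mul1r.
Qed.

Hypothesis geoL : geometric L.

(** The relation for the antichain made of [x] and of an atom whose join with
   [x] is [y]. *)
Lemma flat_class_cover (x y : L) : x != \bot%O -> (x < y)%O -> (rank y <= (rank x).+1)%N ->
  (flat_class y - flat_class x) * flat_class y = 0.
Proof.
move=> x0 ltxy ryx; have [a ata [leay eqy]] := coatom_join geoL ltxy ryx.
have nax : ~~ (a <= x)%O.
  by apply/negP => /join_l e; move: ltxy; rewrite -eqy e ltxx.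
have nxa : ~~ (x <= a)%O.
  apply: contra nax => lexa; suff -> : x = a by [].
  apply: rank_eq => //; rewrite (eqP ata) -(@rank0 _ L).
  by apply: rank_lt; rewrite lt_neqAle eq_sym x0 le0x.
by have := flat_class_incomparable nxa nax; rewrite eqy (flat_class_atom ata) subr0.
Qed.

Variable D : nat -> L.
Hypothesis flagD : modular_flag D.
Local Notation level := (level D).
Local Notation trunc := (trunc D).
Local Notation initial := (initial D).
Local Notation prec := (prec D).
Local Notation compatible := (compatible D).

Definition preceq x y := (x == y) || prec x y.

Definition smaller_pair (A B u v : L) :=
  [&& preceq u A, preceq v B & (u != A) || (v != B)].

Definition nonstandard A B := (A == B) || prec A B && ~~ compatible A B.

Definition rewrites A B := exists s : seq (int * L * L),
  flat_class A * flat_class B = \sum_(c <- s) c.1.1%:~R * (flat_class c.1.2 * flat_class c.2) /\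
  forall c, c \in s -> smaller_pair A B c.1.2 c.2.

Lemma prec_smaller_pairl A B u v : prec u A -> preceq v B -> smaller_pair A B u v.
Proof.
move=> uA vB; rewrite /smaller_pair vB {1}/preceq uA orbT /=.
by rewrite (_ : u != A) //; apply: contraTneq uA => ->; rewrite prec_irr.
Qed.

Lemma prec_smaller_pairr A B u v : preceq u A -> prec v B -> smaller_pair A B u v.
Proof.
move=> uA vB; rewrite /smaller_pair uA {1}/preceq vB orbT /=.
by rewrite (_ : v != B) ?orbT //; apply: contraTneq vB => ->; rewrite prec_irr.
Qed.

Lemma preceq_refl x : preceq x x. Proof. by rewrite /preceq eqxx. Qed.

(** With [J] the join of [A] and [B], the product [h_A * h_B] is reduced by:
   the cover relation of [trunc A] and [A] if [A = B]; this relation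
   and that of [trunc A] and [B] if [B < A]; the relation of [A] and [B] if [A] is not
   initial in [J]; otherwise the relation of [A] and [B] together with the cover
   relation of [B] and [J], or with the relation of [trunc A] and [B]. *)
Lemma nonstandard_rewrites A B : trunc A != \bot%O -> trunc B != \bot%O ->
  nonstandard A B -> rewrites A B.
Proof.
move=> tA0 tB0.
have A0 : A != \bot%O by apply: contraNneq tA0 => ->; rewrite /trunc meet0x.
have B0 : B != \bot%O by apply: contraNneq tB0 => ->; rewrite /trunc meet0x.
have ltA := trunc_lt flagD A0.
have precA : prec (trunc A) A.
  by apply: (initial_prec flagD (initial_trunc flagD A)); rewrite lt_eqF.
have covA := flat_class_cover tA0 ltA (trunc_rank geoL flagD A).
have prr := preceq_refl.
case/orP => [/eqP <-|/andP[ltAB ncAB]].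
  exists [:: (1, A, trunc A)]; rewrite big_seq1 mulr1z mul1r /=; split.
    by apply/eqP; rewrite -subr_eq0 -covA; apply/eqP; ring.
  by move=> c; rewrite inE => /eqP->; apply: prec_smaller_pairr.
have nAB : A != B by apply: contraTneq ltAB => ->; rewrite prec_irr.
have ltBA := negbTE (prec_asym ltAB).
have nleAB : ~~ (A <= B)%O.
  apply/negP => leAB; have [/eqP iAB|] := boolP (initial A B).
    by case/negP: ncAB; rewrite /compatible -iAB eqxx.
  by move=> /(noninitial_prec geoL flagD leAB); rewrite ltBA.
have [leBA|nleBA] := boolP (B <= A)%O.
  have BD : Order.meet B (D (level A)) = B.
    by apply/meet_l/(le_trans leBA); exact: le_level.
  have nleBt : ~~ (B <= trunc A)%O.
    apply: contra ncAB => leBt; rewrite /compatible BD; apply/orP; right.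
    rewrite lt_neqAle leBt andbT; apply: contraFneq ltBA => ->; exact: precA.
  have nletB : ~~ (trunc A <= B)%O.
    apply: contra nleBt => letB; suff -> : B = trunc A by [].
    apply/esym/rank_eq => //; have : (rank B < rank A)%N.
      by apply: rank_lt; rewrite lt_neqAle eq_sym nAB.
    by have := trunc_rank geoL flagD A; move: (rank A) (rank B) (rank (trunc A)); nat_lia.
  have joinA : Order.join (trunc A) B = A.
    apply: rank_eq; first by rewrite leUx leBA trunc_le.
    apply: leq_trans (trunc_rank geoL flagD A) _; apply: rank_lt.
    rewrite lt_neqAle leUl andbT; apply: contraNneq nleBt => ->; exact: leUr.
  have rel := flat_class_incomparable nletB nleBt; rewrite joinA in rel.
  exists [:: (1, trunc A, B)]; rewrite big_seq1 mulr1z mul1r /=; split.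
    have -> : flat_class A * flat_class B = flat_class (trunc A) * flat_class B + (flat_class A - flat_class (trunc A)) * flat_class A
        - (flat_class A - flat_class (trunc A)) * (flat_class A - flat_class B) by ring.
    by rewrite covA rel addr0 subr0.
  by move=> c; rewrite inE => /eqP->; apply: prec_smaller_pairl.
set J := Order.join A B; have rel := flat_class_incomparable nleAB nleBA.
rewrite -/J in rel.
have leAJ : (A <= J)%O by exact: leUl.
have leBJ : (B <= J)%O by exact: leUr.
have nBJ : B != J by apply: contraNneq nleAB => ->.
have [iAJ|niAJ] := boolP (initial A J); last first.
  have ltJA := noninitial_prec geoL flagD leAJ niAJ.
  have ltJB : prec J B.
    apply: (noninitial_prec geoL flagD leBJ); apply: contraFN ltBA => iBJ.
    exact: prec_trans (initial_prec flagD iBJ nBJ) ltJA.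
  exists [:: (1, A, J); (1, J, B); (-1, J, J)].
  rewrite !big_cons big_nil /= !mulrN1z !mulr1z addr0; split.
    have -> : flat_class A * flat_class B = flat_class A * flat_class J + flat_class J * flat_class B - flat_class J * flat_class J +
        (flat_class J - flat_class A) * (flat_class J - flat_class B) by ring.
    by rewrite rel; ring.
  move=> c; rewrite !inE => /or3P[] /eqP-> /=.
  - exact: prec_smaller_pairr.
  - exact: prec_smaller_pairl.
  - by apply: prec_smaller_pairl => //; rewrite /preceq ltJB orbT.
have ltJB : prec J B.
  apply: (noninitial_prec geoL flagD leBJ); apply/negP => iBJ.
  have [lev|/ltnW lev] := leqP (level A) (level B).
    by case/negP: nleAB; exact: initial_le (initial_level flagD iAJ iBJ lev).
  by case/negP: nleBA; exact: initial_le (initial_level flagD iBJ iAJ lev).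
set C := Order.meet B (D (level A)).
have leCA : (C <= A)%O by rewrite (eqP iAJ) leI2.
have leCB : (C <= B)%O by exact: leIl.
have nCA : C != A by apply: contra ncAB => e; rewrite /compatible -/C e.
have [leCt|nleCt] := boolP (C <= trunc A)%O.
  have eC : C = trunc A.
    apply/eqP; apply: contraNT ncAB => nC; apply/orP; right.
    by rewrite lt_neqAle nC leCt.
  have [a ata [leaA eA]] := coatom_join geoL ltA (trunc_rank geoL flagD A).
  have eJ : Order.join B a = J.
    apply/le_anti/andP; split; first by rewrite leUx leBJ (le_trans leaA).
    by rewrite leUx leUl andbT -[X in (X <= _)%O]eA leUx leUr andbT -eC (le_trans leCB) ?leUl.
  have naB : ~~ (a <= B)%O by apply: contra nleAB => aB; rewrite -eA leUx aB -eC leCB.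
  have covB : (flat_class J - flat_class B) * flat_class J = 0.
    apply: flat_class_cover => //; first by rewrite lt_neqAle nBJ.
    by rewrite -eJ rank_join_atom.
  exists [:: (1, A, J)]; rewrite big_seq1 mulr1z mul1r /=; split.
    have -> : flat_class A * flat_class B = flat_class A * flat_class J + (flat_class J - flat_class A) * (flat_class J - flat_class B)
        - (flat_class J - flat_class B) * flat_class J by ring.
    by rewrite rel covB addr0 subr0.
  by move=> c; rewrite inE => /eqP->; apply: prec_smaller_pairr.
have joinAC : Order.join (trunc A) C = A.
  apply: rank_eq; first by rewrite leUx leCA trunc_le.
  apply: leq_trans (trunc_rank geoL flagD A) _; apply: rank_lt.
  rewrite lt_neqAle leUl andbT; apply: contraNneq nleCt => ->; exact: leUr.
have joinJ : Order.join (trunc A) B = J.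
  apply: le_anti; rewrite leUx leBJ (le_trans (trunc_le D A)) //= leUx leUr andbT.
  by rewrite -{1}joinAC leU2.
have nletB : ~~ (trunc A <= B)%O.
  apply: contra nCA => letB; have letC : (trunc A <= C)%O.
    by rewrite lexI letB (le_trans (trunc_le D A)) ?le_level.
  by rewrite -[X in _ == X]joinAC (join_r letC).
have nleBt : ~~ (B <= trunc A)%O.
  by apply: contra nleBA => /le_trans; apply; exact: trunc_le.
have rel' := flat_class_incomparable nletB nleBt; rewrite joinJ in rel'.
exists [:: (1, trunc A, B); (1, A, J); (-1, trunc A, J)].
rewrite !big_cons big_nil /= !mulrN1z !mulr1z addr0; split.
  have -> : flat_class A * flat_class B = flat_class (trunc A) * flat_class B + flat_class A * flat_class J - flat_class (trunc A) * flat_class J +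
      (flat_class J - flat_class A) * (flat_class J - flat_class B) - (flat_class J - flat_class (trunc A)) * (flat_class J - flat_class B) by ring.
  by rewrite rel rel'; ring.
move=> c; rewrite !inE => /or3P[] /eqP-> /=.
- exact: prec_smaller_pairl.
- exact: prec_smaller_pairr.
- by apply: prec_smaller_pairl => //; rewrite /preceq ltJB orbT.
Qed.

End ChowRing.

(** * The monomial order and the basis *)

Lemma lexi_map_add (I : Type) (s : seq I) (f g h : I -> nat) :
  (([seq (f i + h i)%N | i <- s] : seqlexi nat) <= ([seq (g i + h i)%N | i <- s] : seqlexi nat))%O =
  (([seq f i | i <- s] : seqlexi nat) <= ([seq g i | i <- s] : seqlexi nat))%O.
Proof.
by elim: s => //= i s IH; rewrite !lexi_cons !leEnat !leq_add2r IH.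
Qed.

Section Pairs.
Variables (n : nat) (le : rel 'X_{1..n}).

Definition below (m0 : 'X_{1..n}) (p : {mpoly int[n]}) :=
  forall m, ~~ (le m m0 && (m != m0)) -> p@_m = 0.

Lemma below0 m0 : below m0 0. Proof. by move=> m _; rewrite mcoeff0. Qed.

Lemma below_sum m0 (I : eqType) (s : seq I) (F : I -> {mpoly int[n]}) :
  (forall i, i \in s -> below m0 (F i)) -> below m0 (\sum_(i <- s) F i).
Proof. by move=> H m nm; rewrite raddf_sum big_seq big1 // => i /H; apply. Qed.

Lemma belowZ m0 c p : below m0 p -> below m0 (c *: p).
Proof. by move=> H m nm; rewrite mcoeffZ H ?mulr0. Qed.

Lemma belowX m0 m : le m m0 -> m != m0 -> below m0 'X_[m].
Proof.
move=> lem nem m'; rewrite mcoeffX; case: (eqVneq m m') => [<-|//].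
by rewrite lem nem.
Qed.

Lemma leading_sub_below m0 p : reflexive le -> below m0 p ->
  leading_monomial le ('X_[m0] - p) m0 /\ ('X_[m0] - p)@_m0 = 1.
Proof.
move=> lexx_ bp; have c1 : ('X_[m0] - p)@_m0 = 1.
  by rewrite mcoeffB mcoeffX eqxx bp ?subr0 // eqxx andbF.
split=> //; split; first by rewrite mcoeff_msupp c1 oner_eq0.
move=> m; rewrite mcoeff_msupp mcoeffB mcoeffX; case: (eqVneq m0 m) => [<- //|ne].
by apply: contraNT => nle; rewrite bp ?subr0 // (negbTE nle).
Qed.
End Pairs.

(** Each homogeneous component of [c * g] is again a multiple of [g]. *)
Lemma pihomog_mul_kernel n (S : comNzRingType) (f : {rmorphism {mpoly int[n]} -> S})
    (c g : {mpoly int[n]}) e k :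
  g \is e.-homog -> f g = 0 -> f (pihomog mdeg k (c * g)) = 0.
Proof.
move=> hg fg; rewrite [c](@pihomog_partitionE _ _ mdeg (mmeasure mdeg c)) // mulr_suml.
rewrite linear_sum raddf_sum big1 // => i _ /=.
have hig : pihomog mdeg i c * g \is (i + e)%N.-homog by apply: dhomogM => //; exact: pihomogP.
have [<-|ne] := eqVneq (i + e)%N k; first by rewrite pihomog_dE // rmorphM fg mulr0.
by rewrite (pihomog_ne0 ne hig) rmorph0.
Qed.

Section Presentation.
Context {d : Order.disp_t} {L : finTBLatticeType d}.
Local Notation G := (Gmax L).
Local Notation FY := (FYmax L).
Local Notation n := #|nonatoms L|.
Local Notation P := {mpoly int[n]}.
Local Notation mon := 'X_{1..n}.

Definition gen_flat (i : 'I_n) : L := val (val (enum_val i)).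

Lemma gen_flat_inj : injective gen_flat.
Proof. by move=> i j /val_inj/val_inj/enum_val_inj. Qed.

Lemma gen_flat_nonatom i : ~~ atom (gen_flat i).
Proof. exact: (valP (enum_val i)). Qed.

Lemma gen_flat_neq0 i : gen_flat i != \bot%O.
Proof. exact: (valP (val (enum_val i))). Qed.

Lemma gen_flat_surj (y : L) : y != \bot%O -> ~~ atom y -> exists i, gen_flat i = y.
Proof.
move=> y0 ay; pose a : nonatoms L := exist _ (exist _ y y0 : G) ay.
by exists (enum_rank a); rewrite /gen_flat enum_rankK.
Qed.

Definition flat_var (y : L) : P := if [pick i | gen_flat i == y] is Some i then 'X_i else 0.

Lemma flat_varE i : flat_var (gen_flat i) = 'X_i.
Proof.
rewrite /flat_var; case: pickP => [j /eqP/gen_flat_inj->//|/(_ i)].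
by rewrite eqxx.
Qed.

Lemma flat_var_homog y : flat_var y \is 1.-homog.
Proof. by rewrite /flat_var; case: pickP => [i _|_]; rewrite ?dhomog0 // dhomogX /= mdeg1. Qed.

Definition gen_eval : P -> FY := mmap intr (@FYgen d L).
HB.instance Definition _ := GRing.RMorphism.on gen_eval.

Lemma gen_evalX i : gen_eval 'X_i = flat_class (gen_flat i).
Proof. by rewrite /gen_eval mmapX mmap1U /FYgen -flat_classE. Qed.

Lemma gen_eval_flat_var y : gen_eval (flat_var y) = flat_class y.
Proof.
rewrite /flat_var; case: pickP => [i /eqP <-|none]; first exact: gen_evalX.
rewrite rmorph0; have [ay|nay] := boolP (atom y); first by rewrite flat_class_atom.
have [->|y0] := eqVneq y \bot%O; first by rewrite /flat_class insubF // eqxx.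
by have [i /eqP] := gen_flat_surj y0 nay; rewrite none.
Qed.

(** A left inverse of [lift_gens] compatible with the projections to the Chow
   ring, through which homogeneity of the relations reaches the kernel. *)
Definition kill_atoms : wond_polyring L -> P := mmap intr (fun i => flat_var (val (enum_val i : G))).
HB.instance Definition _ := GRing.RMorphism.on kill_atoms.

Definition lift_gens : P -> wond_polyring L := mmap intr (fun i : 'I_n => hvar (val (enum_val i))).
HB.instance Definition _ := GRing.RMorphism.on lift_gens.

Lemma kill_atoms_hvar (x : G) : kill_atoms (hvar x) = flat_var (val x).
Proof. by rewrite /kill_atoms /hvar mmapX mmap1U enum_rankK. Qed.

Lemma lift_gens_X i : lift_gens 'X_i = hvar (val (enum_val i)).
Proof. by rewrite /lift_gens mmapX mmap1U. Qed.

Lemma gen_eval_kill_atoms q : gen_eval (kill_atoms q) = FYproj q.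
Proof.
apply: (mpoly_rmorph_eq (f := gen_eval \o kill_atoms) (g := @FYproj d L)) => i /=.
rewrite -[in LHS](enum_valK i) kill_atoms_hvar gen_eval_flat_var flat_classE.
by rewrite /FYh /FYproj /hvar enum_valK.
Qed.

Lemma kill_atoms_lift_gens p : kill_atoms (lift_gens p) = p.
Proof.
apply: (mpoly_rmorph_eq (f := kill_atoms \o lift_gens) (g := idfun)) => i /=.
by rewrite lift_gens_X kill_atoms_hvar flat_varE.
Qed.

Lemma gen_eval_lift_gens p : gen_eval p = FYproj (lift_gens p).
Proof. by rewrite -gen_eval_kill_atoms kill_atoms_lift_gens. Qed.

Lemma gen_eval_surj a : exists p, gen_eval p = a.
Proof. by have [q <-] := FYproj_surj a; exists (kill_atoms q); rewrite gen_eval_kill_atoms. Qed.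

Lemma relation_homog r : wond_relation r -> exists e, kill_atoms r \is e.-homog.
Proof.
case=> [H _|g A _ _]; first by exists 1%N; rewrite kill_atoms_hvar flat_var_homog.
rewrite rmorph_prod; apply: (big_ind (fun p => exists e, p \is e.-homog)).
- by exists 0%N; exact: dhomog1.
- by move=> p q [e hp] [e' hq]; exists (e + e')%N; exact: dhomogM.
- by move=> x _; exists 1%N; rewrite rmorphB /= !kill_atoms_hvar rpredB ?flat_var_homog.
Qed.

Lemma gen_eval_homogeneous : homogeneous_ideal (fun p => gen_eval p = 0).
Proof.
move=> p k; rewrite gen_eval_lift_gens => /FYproj_eq0[l [c [r [relr ep]]]].
rewrite -(kill_atoms_lift_gens p) ep (rmorph_sum kill_atoms) linear_sum rmorph_sum big1 //= => i _.
have [e he] := relation_homog (relr i); rewrite rmorphM.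
apply: (pihomog_mul_kernel (f := gen_eval) _ _ he); rewrite /= gen_eval_kill_atoms.
apply/FYproj_eq0; exists 1%N, (fun=> 1), (fun=> r i); split=> //.
by rewrite big_ord1 mul1r.
Qed.

Definition lift_mon (m : mon) : 'X_{1..#|G|} :=
  (\sum_(i < n) U_(enum_rank (val (enum_val i))) *+ m i)%MM.

Lemma lift_gens_mon m : lift_gens 'X_[m] = 'X_[lift_mon m].
Proof.
rewrite /lift_gens mmapX /mmap1 /lift_mon (big_morph _ (@mpolyXD _ _) (@mpolyX0 _ _)).
apply: eq_bigr => i _.
by rewrite -mpolyXn.
Qed.

Lemma sum_lift_mon (Q : pred G) m :
  (\sum_(y : G | Q y) lift_mon m (enum_rank y) = \sum_(i < n | Q (val (enum_val i))) m i)%N.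
Proof.
under eq_bigr do rewrite mnm_sumE.
rewrite exchange_big /= [RHS]big_mkcond; apply: eq_bigr => i _.
under eq_bigr do rewrite mulmnE mnm1E (inj_eq enum_rank_inj).
rewrite big_mkcond (bigD1 (val (enum_val i))) //= eqxx mul1n big1 ?addn0 // => y ne.
by rewrite eq_sym (negbTE ne) if_same.
Qed.

Lemma mdeg_lift_mon m : mdeg (lift_mon m) = mdeg m.
Proof.
rewrite mdegE (reindex (@enum_rank G)) /=; last exact: (onW_bij _ (enum_rank_bij _)).
by rewrite (sum_lift_mon predT) mdegE.
Qed.

Section Groebner.
Hypothesis geoL : geometric L.
Variable D : nat -> L.
Hypothesis flagD : modular_flag D.
Local Notation trunc := (trunc D).
Local Notation prec := (prec D).

Definition tail (m : mon) (v : 'I_n) : nat := (\sum_(i < n | ~~ prec (gen_flat i) (gen_flat v)) m i)%N.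

(** Tails are additive and determine the monomial, so their lexicographic
   comparison is a monomial order for any enumeration of the generators. *)
Definition tail_seq (m : mon) : seqlexi nat := [seq tail m v | v <- enum 'I_n].

Definition tail_le : rel mon := fun m1 m2 => (tail_seq m1 <= tail_seq m2)%O.

Lemma tailD m1 m2 v : tail (m1 + m2)%MM v = (tail m1 v + tail m2 v)%N.
Proof. by rewrite /tail -big_split; apply: eq_bigr => i _; rewrite mnmDE. Qed.

Lemma tailU i v : tail U_(i)%MM v = ~~ prec (gen_flat i) (gen_flat v).
Proof.
rewrite /tail; under eq_bigr do rewrite mnm1E.
rewrite big_mkcond (bigD1 i) //= eqxx big1 ?addn0 => [|j ne]; first by case: ifP.
by rewrite eq_sym (negbTE ne) if_same.
Qed.

(** At a largest generator where the exponents differ, the tails differ too. *)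
Lemma tail_inj m1 m2 : tail m1 =1 tail m2 -> m1 = m2.
Proof.
move=> et; apply/eqP; apply: contraT => ne.
have [i0 d0] : exists i, m1 i != m2 i.
  apply/existsP; apply: contraR ne; rewrite negb_exists => /forallP H.
  by apply/eqP/mnmP => i; apply/eqP; have := H i; rewrite negbK.
pose N i := #|[set j | prec (gen_flat j) (gen_flat i)]|.
case: (@arg_maxnP _ i0 (fun i => m1 i != m2 i) N d0) => i di imax.
have := et i; rewrite /tail (bigD1 i) ?prec_irr //= [RHS](bigD1 i) ?prec_irr //=.
rewrite (eq_bigr m2) => [/addIn /eqP|j /andP[nji neji]]; first by rewrite (negbTE di).
apply/eqP; apply: contraT => dj; have := imax j dj; rewrite /= leqNgt => /negP[].
have lij : prec (gen_flat i) (gen_flat j).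
  have nij : gen_flat i != gen_flat j by rewrite (inj_eq gen_flat_inj) eq_sym.
  by have := prec_total D nij; rewrite (negbTE nji) orbF.
apply: proper_card; apply/properP; split.
  by apply/subsetP => l; rewrite !inE => /prec_trans; apply.
by exists i; rewrite !inE ?prec_irr.
Qed.

Lemma nth_tail_seq m (v : 'I_n) : nth 0%N (tail_seq m) v = tail m v.
Proof.
have szv : (v < size (enum 'I_n))%N by rewrite size_enum_ord.
by rewrite /tail_seq (nth_map v _ _ szv) nth_ord_enum.
Qed.

Lemma size_tail_seq m : size (tail_seq m) = n.
Proof. by rewrite /tail_seq size_map size_enum_ord. Qed.

Lemma tail_le_tail m1 m2 : (forall v, (tail m1 v <= tail m2 v)%N) -> tail_le m1 m2.
Proof.
move=> H; apply: lexi_le_nth; first by rewrite !size_tail_seq.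
move=> i; have [lt|ge] := ltnP i n; last by rewrite !nth_default ?size_tail_seq.
by rewrite (nth_tail_seq m1 (Ordinal lt)) (nth_tail_seq m2 (Ordinal lt)).
Qed.

Lemma tail_le_monomial_order : monomial_order tail_le.
Proof.
split; [split | split].
- by move=> m; rewrite /tail_le lexx.
- move=> m1 m2 /andP[l1 l2]; apply: tail_inj => v.
  have e : tail_seq m1 = tail_seq m2 :> seqlexi nat by apply/le_anti/andP.
  by rewrite -!nth_tail_seq e.
- by move=> m2 m1 m3; exact: le_trans.
- by move=> m1 m2; exact: le_total.
- by move=> m; apply: tail_le_tail => v; rewrite /tail big1 // => i _; rewrite mnm0E.
- move=> m1 m2 m; rewrite /tail_le /tail_seq.
  rewrite -(lexi_map_add _ (tail m1) (tail m2) (tail m)).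
  congr (_ <= _)%O; by apply: eq_map => v; rewrite tailD.
Qed.

Lemma tail_le_add_smaller i j i' j' :
    smaller_pair D (gen_flat i) (gen_flat j) (gen_flat i') (gen_flat j') ->
  tail_le (U_(i') + U_(j'))%MM (U_(i) + U_(j))%MM /\ (U_(i') + U_(j'))%MM != (U_(i) + U_(j))%MM.
Proof.
have tle k l v : preceq D (gen_flat k) (gen_flat l) -> (tail U_(k)%MM v <= tail U_(l)%MM v)%N.
  move=> /orP[/eqP/gen_flat_inj-> //|lt]; rewrite !tailU.
  case lv: (prec (gen_flat l) (gen_flat v)); last by case: (prec _ _).
  by rewrite (prec_trans lt lv).
have tlt k l : preceq D (gen_flat k) (gen_flat l) -> gen_flat k != gen_flat l -> (tail U_(k)%MM l < tail U_(l)%MM l)%N.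
  by move=> /orP[->//|lt] _; rewrite !tailU lt prec_irr.
move=> /and3P[li lj ne]; split.
  by apply: tail_le_tail => v; rewrite !tailD leq_add ?tle.
case/orP: ne => ne; apply: contraTneq (tlt _ _ _ ne) => // e; rewrite -leqNgt.
  by have := tle j' j i lj; move: (congr1 (tail ^~ i) e); rewrite !tailD; nat_lia.
by have := tle i' i j li; move: (congr1 (tail ^~ j) e); rewrite !tailD; nat_lia.
Qed.

Lemma below_smaller i j u v : smaller_pair D (gen_flat i) (gen_flat j) u v ->
  below tail_le (U_(i) + U_(j))%MM (flat_var u * flat_var v).
Proof.
rewrite /flat_var; case: pickP => [i' /eqP<-|_]; last by rewrite mul0r => _; exact: below0.
case: pickP => [j' /eqP<-|_]; last by rewrite mulr0 => _; exact: below0.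
by move=> /tail_le_add_smaller[le ne]; rewrite -mpolyXD; exact: belowX.
Qed.

Lemma gen_flat_trunc i : trunc (gen_flat i) != \bot%O.
Proof.
apply: contraNneq (gen_flat_nonatom i) => e; rewrite /atom eqn_leq.
have := trunc_rank geoL flagD (gen_flat i); rewrite e rank0 => -> /=.
by rewrite -(@rank0 _ L); apply: rank_lt; rewrite lt_neqAle eq_sym gen_flat_neq0 le0x.
Qed.

Definition nonstandard_pair (ij : 'I_n * 'I_n) := nonstandard D (gen_flat ij.1) (gen_flat ij.2).

Definition rewriting_rule ij (p : P) : Prop :=
  [/\ gen_eval p = 0, p \is 2.-homog,
      leading_monomial tail_le p (U_(ij.1) + U_(ij.2))%MM & p@_(U_(ij.1) + U_(ij.2)) = 1].

Lemma nonstandard_pair_relation ij : nonstandard_pair ij -> exists p, rewriting_rule ij p.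
Proof.
case: ij => i j ns; have [s [es ss]] := nonstandard_rewrites geoL flagD (gen_flat_trunc i) (gen_flat_trunc j) ns.
pose r : P := \sum_(c <- s) c.1.1 *: (flat_var c.1.2 * flat_var c.2).
have br : below tail_le (U_(i) + U_(j))%MM r.
  by apply: below_sum => c /ss; exact/(fun h => belowZ _ (below_smaller h)).
have [[mlexx _ _ _] _] := tail_le_monomial_order.
have [lm c1] := leading_sub_below mlexx br.
exists ('X_[U_(i) + U_(j)] - r); split=> //.
  rewrite rmorphB mpolyXD rmorphM /= !gen_evalX es rmorph_sum; apply/eqP; rewrite subr_eq0; apply/eqP.
  apply: eq_bigr => c _; rewrite -mul_mpolyC rmorphM rmorphM /= !gen_eval_flat_var; congr (_ * _).
  by rewrite /gen_eval mmapC.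
apply: rpredB; first by rewrite dhomogX /= mdegD !mdeg1.
apply: rpred_sum => c _; apply: dhomogZ.
by apply: (@dhomogM _ _ _ 1%N _ 1%N); exact: flat_var_homog.
Qed.

(** Otherwise the factors of [m], sorted from last to first, are as required by
   [standard_flag], whose functional is 1 at [m] and 0 at the other monomials of
   [p]: those on which it is nonzero are not smaller than [m]. *)
Lemma leading_nonstandard_pair p m : gen_eval p = 0 -> leading_monomial tail_le p m ->
  exists2 ij, nonstandard_pair ij & (U_(ij.1) + U_(ij.2) <= m)%MM.
Proof.
move=> kerp [mp mtop]; apply: contrapT => Hno.
have std i j : nonstandard D (gen_flat i) (gen_flat j) -> ~~ (U_(i) + U_(j) <= m)%MM.
  by move=> ns; apply/negP => le; apply: Hno; exists (i, j).
have sqfree i : (m i <= 1)%N.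
  rewrite leqNgt; apply/negP => lt; have /negP[] := std i i (introT orP (or_introl (eqxx _))).
  apply/mnm_lepP => k; rewrite mnmDE mnm1E; case: eqP => [<-|_] //.
pose sup := [seq gen_flat i | i <- enum 'I_n & (0 < m i)%N].
have usup : uniq sup by rewrite (map_inj_uniq gen_flat_inj) filter_uniq ?enum_uniq.
pose gec : rel L := fun x y => ((code D y : seqlexi nat) <= (code D x : seqlexi nat))%O.
pose t := sort gec sup.
have gec_total : total gec by move=> x y; exact: le_total.
have gec_trans : transitive gec by move=> y x z xy yz; exact: le_trans yz xy.
have memt x : (x \in t) = [exists i, (0 < m i)%N && (gen_flat i == x)].
  rewrite mem_sort; apply/mapP/existsP => [[i]|[i /andP[mi /eqP<-]]].
    by rewrite mem_filter => /andP[mi _] ->; exists i; rewrite mi eqxx.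
  by exists i; rewrite // mem_filter mi mem_enum.
have ut : uniq t by rewrite sort_uniq.
have tP l : (l < size t)%N -> exists2 i, (0 < m i)%N & nth \bot%O t l = gen_flat i.
  by move=> lt; have := mem_nth \bot%O lt; rewrite memt => /existsP[i /andP[mi /eqP<-]]; exists i.
have tprec i l : (i < l < size t)%N -> prec (nth \bot%O t l) (nth \bot%O t i).
  move=> /andP[il lt]; have it := ltn_trans il lt.
  have := sorted_ltn_nth gec_trans \bot%O (sort_sorted gec_total sup).
  move=> /(_ i l); rewrite !inE => /(_ it lt il) le.
  have ne : nth \bot%O t l != nth \bot%O t i by rewrite nth_uniq // gtn_eqF.
  have := prec_total D ne; case/orP => // lt'.
  by move: lt'; rewrite /prec ltNge => /negP[].
have tcompat i l : (i < l < size t)%N -> compatible D (nth \bot%O t l) (nth \bot%O t i).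
  move=> ilt; have lp := tprec i l ilt; have /andP[il lt] := ilt.
  have [a ma ea] := tP l lt; have [b mb eb] := tP i (ltn_trans il lt).
  apply: contraT => nc; have ns : nonstandard D (gen_flat a) (gen_flat b).
    by rewrite -ea -eb /nonstandard lp nc orbT.
  have /negP[] := std _ _ ns; apply/mnm_lepP => k; rewrite mnmDE !mnm1E.
  have nab : a != b by apply: contraTneq lp => e; rewrite ea eb e prec_irr.
  by case: eqP => [<-|_]; [rewrite eq_sym (negbTE nab) addn0 | case: eqP => [<-|_]].
have ttrunc x : x \in t -> (\bot < trunc x)%O.
  by rewrite memt => /existsP[i /andP[_ /eqP<-]]; rewrite lt_neqAle eq_sym gen_flat_trunc le0x.
have [F [live [N [[F0 FN Fle] adm1 prec1]]]] := standard_flag geoL flagD ttrunc tprec tcompat.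
set k := #|[set s in t]| in adm1 prec1.
have esup : support_mnm t = lift_mon m.
  apply/mnmP => j; rewrite -(enum_valK j); set y : G := enum_val j.
  have -> : lift_mon m (enum_rank y) = (\sum_(i < n | val (enum_val i) == y) m i)%N.
    by rewrite -(sum_lift_mon (pred1 y)) big_pred1_eq.
  have -> : support_mnm t (enum_rank y) = (val y \in t).
    rewrite /support_mnm mnm_sumE big_mkcond (bigD1 y) //= big1 => [|x ne].
      by rewrite addn0; case: ifP => // _; rewrite mnm1E eqxx.
    by case: ifP => // _; rewrite mnm1E (inj_eq enum_rank_inj) (negbTE ne).
  rewrite memt; case: existsP => [[i /andP[mi /eqP ei]]|none].
    rewrite (bigD1 i) /=; last by apply/eqP/val_inj; exact: ei.
    have -> : m i = 1%N by apply/eqP; rewrite eqn_leq sqfree mi.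
    rewrite big1 // => i' /andP[/eqP ei' ne]; case/negP: ne; apply/eqP/gen_flat_inj.
    exact: etrans (congr1 val ei') (esym ei).
  rewrite big1 // => i /eqP ei; apply/eqP; rewrite -leqn0 leqNgt; apply/negP => mi.
  by apply: none; exists i; rewrite mi; apply/eqP; exact: (congr1 val ei).
rewrite esup in adm1.
pose psi := flag_functional F live k.
have psiE : psi (lift_gens p) = \sum_(m' <- msupp p) p@_m' * psi 'X_[lift_mon m'].
  rewrite {1}[p]mpolyE rmorph_sum /psi /flag_functional raddf_sum; apply: eq_bigr => m' _.
  rewrite -mul_mpolyC rmorphM /= lift_gens_mon /lift_gens mmapC.
  by rewrite mulrzl raddfMz -mulrzl /= intz.
have : psi (lift_gens p) = 0.
  by apply: (functional_ideal geoL live k F0 FN Fle); apply/FYproj_eq0; rewrite -gen_eval_lift_gens.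
rewrite psiE (bigD1_seq m) ?msupp_uniq //=.
rewrite /psi (functional1 adm1) mulr1 big1_seq ?addr0 => [/eqP|m' /andP[ne m'p]].
  by rewrite mcoeff_eq0 mp.
rewrite functional0 ?mulr0 // => adm2.
have edeg : mdeg m = mdeg m' by rewrite -!mdeg_lift_mon; case: adm1 => _ ->; case: adm2 => _ ->.
suff : m = m' by move=> e; rewrite e eqxx in ne.
have [[_ antile _ _] _] := tail_le_monomial_order; apply: antile.
rewrite mtop // andbT; apply: tail_le_tail => v.
have le : (\sum_(i < n | prec (gen_flat i) (gen_flat v)) m' i <= \sum_(i < n | prec (gen_flat i) (gen_flat v)) m i)%N.
  have := prec1 (lift_mon m') (gen_flat v) adm2.
  rewrite (sum_lift_mon (fun y => prec (val y) (gen_flat v))) => /leq_trans; apply.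
  have -> : [set p0 in t | prec p0 (gen_flat v)] = gen_flat @: [set i | (0 < m i)%N && prec (gen_flat i) (gen_flat v)].
    apply/setP => x; rewrite !inE memt; apply/andP/imsetP => [[/existsP[i /andP[mi /eqP<-]] pv]|[i]].
      by exists i; rewrite // inE mi.
    by rewrite inE => /andP[mi pv] ->; split=> //; apply/existsP; exists i; rewrite mi eqxx.
  rewrite (card_imset _ gen_flat_inj) -sum1_card big_mkcond [leqRHS]big_mkcond /=.
  by apply: leq_sum => i _; rewrite inE; case: posnP => //= mi; case: ifP.
move: edeg le; rewrite !mdegE (bigID (fun i => prec (gen_flat i) (gen_flat v))) /=.
rewrite [X in _ = X -> _](bigID (fun i => prec (gen_flat i) (gen_flat v))) /= -!/(tail _ v).
by move=> e le; rewrite -(leq_add2l (\sum_(i < n | prec (gen_flat i) (gen_flat v)) m' i)) -e leq_add2r.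
Qed.

End Groebner.
End Presentation.

Theorem corollary3p7 (d : Order.disp_t) (L : finTBLatticeType d) :
  geometric L -> supersolvable L ->
  admits_quadratic_groebner_basis (@FYgen d L).
Proof.
move=> geoL /(supersolvable_modular_flag geoL)[D flagD].
split; [exact: gen_eval_surj | exact: gen_eval_homogeneous |].
exists (tail_le D); first exact: tail_le_monomial_order.
have rule ij : exists p, nonstandard_pair D ij -> rewriting_rule D ij p.
  have [/(nonstandard_pair_relation geoL flagD)[p]|_] := boolP (nonstandard_pair D ij); last by exists 0.
  by exists p.
have [b Hb] := boolp.choice rule.
exists [seq b ij | ij <- enum [pred ij | nonstandard_pair D ij]].
  split.
  - by move=> p /mapP[ij]; rewrite mem_enum => /Hb[? _ _ _] ->.
  - move=> p /mapP[ij]; rewrite mem_enum => /Hb[_ _ lm c1] ->.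
    by exists (U_(ij.1) + U_(ij.2))%MM; rewrite // c1 eqxx.
  move=> t0; split=> [|] [k [c [g [Hg ->]]]].
    elim: k c g Hg => [|k IH] c g Hg; first by rewrite big_ord0; exact: generated_ideal0.
    rewrite big_ord_recl; apply: generated_idealD; last first.
      by apply: (IH (fun i => c (lift ord0 i)) (fun i => g (lift ord0 i))) => i.
    apply: generated_idealM; have [p [m [kp lm ->]]] := Hg ord0.
    have [ij ns le] := leading_nonstandard_pair geoL flagD kp lm; have [_ _ lmb c1] := Hb ij ns.
    rewrite -(submK le) mpolyXD scalerAl; apply: generated_idealM.
    exists 1%N, (fun=> 1), (fun=> 'X_[U_(ij.1) + U_(ij.2)]); split; last by rewrite big_ord1 mul1r.
    move=> _; exists (b ij), (U_(ij.1) + U_(ij.2))%MM; split=> //; last by rewrite c1 scale1r.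
    by apply/mapP; exists ij; rewrite // mem_enum.
  exists k, c, g; split=> // i; have [p [m [pB lm ->]]] := Hg i.
  exists p, m; split=> //; move: pB => /mapP[ij]; rewrite mem_enum => /Hb[kb _ _ _] ->.
  exact: kb.
by move=> p /mapP[ij]; rewrite mem_enum => /Hb[_ hb _ _] ->.
Qed.
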